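(* Let $\rho\in(0,\infty)$, and for each $n\ge 1$ let $m=m(n)\in\mathbb{Z}_+$ be such that $m/n\to\rho$ as $n\to\infty$. For each $n$ let $(\eta(t):t\ge 0)$ be the mean-field zero-range process with $n$ sites and $m$ particles started from a deterministic configuration $\eta=\eta^{(n)}\in\Omega$ such that $\eta_1\ge\eta_2\ge\cdots\ge\eta_n$ and such that for each fixed $k\ge 1$, $\eta_k/n\to u_k$ as $n\to\infty$, where $(u_k)_{k\ge 1}$ is a non-increasing sequence of non-negative numbers. Then there are deterministic measurable functions $\mathfrak{v}_i:\mathbb{R}_+\to[0,u_i]$, $i\ge 1$, satisfying $$\mathfrak{v}_i(t)=\left(u_i-\int_0^t\frac{1}{1+\rho-\sum_{j=1}^\infty\mathfrak{v}_j(s)}\,ds\right)_+\qquad\text{for all }i\ge 1,\ t\ge 0,$$ such that for any fixed $T\ge 0$ and $i\ge 1$, $$\sup_{t\in[0,T]}\left|\frac{\eta_i(nt)}{n}-\mathfrak{v}_i(t)\right|\ \xrightarrow[n\to\infty]{\mathbb{P}}\ 0.$$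
   Context: Mean-field zero-range process: for integers $n\ge 1$, $m\ge 0$, the state space is $\Omega=\{\eta\in\mathbb{Z}_+^n:\eta_1+\cdots+\eta_n=m\}$, and the continuous-time Markov generator acts on $f:\Omega\to\mathbb{R}$ by $$(\mathcal{L}f)(\eta)=\frac1n\sum_{1\le i,j\le n}\mathbf{1}_{(\eta_i>0)}\left(f(\eta+\delta^j-\delta^i)-f(\eta)\right),$$ where $\delta^i_k=1$ if $k=i$ and $0$ otherwise. Notation: $x_+=\max(x,0)$; $\xrightarrow{\mathbb{P}}$ denotes convergence in probability. Under the stated assumptions $\sum_{i\ge1}u_i\le\rho$ by Fatou's lemma, so the denominator is at least $1$. *)

(* Defs.v *)
From mathcomp Require Import all_boot all_order all_algebra.
From mathcomp Require Import all_classical all_reals all_analysis.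

Set Implicit Arguments.
Unset Strict Implicit.
Unset Printing Implicit Defensive.

Import Order.TTheory GRing.Theory Num.Theory.
Import numFieldNormedType.Exports.

Local Open Scope classical_set_scope.
Local Open Scope ring_scope.

Definition Omega (n m : nat) : Type :=
  {eta : {ffun 'I_n -> nat} | (\sum_(i < n) eta i)%N == m}.

Definition occ (n m : nat) (eta : Omega n m) : {ffun 'I_n -> nat} := val eta.

(* Sites are numbered from 0. The value 0 at k >= n is only a convention: for
   a fixed k it is irrelevant as soon as n > k. *)
Definition site (n m : nat) (eta : Omega n m) (k : nat) : nat :=
  oapp (occ eta) 0%N (insub k).

Definition move_raw (n : nat) (eta : {ffun 'I_n -> nat}) (i j : 'I_n) :
    {ffun 'I_n -> nat} :=
  [ffun k => (eta k + (k == j) - (k == i))%N].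

(* eta + delta^j - delta^i when eta_i > 0 (see [occ_move]); the value eta
   otherwise is never used by the generator. *)
Definition move (n m : nat) (eta : Omega n m) (i j : 'I_n) : Omega n m :=
  insubd eta (move_raw (occ eta) i j).

Lemma move_raw_sum (n : nat) (eta : {ffun 'I_n -> nat}) (i j : 'I_n) :
  (0 < eta i)%N ->
  (\sum_(k < n) move_raw eta i j k = \sum_(k < n) eta k)%N.
Proof.
move=> eta_i; apply/(@addIn 1%N).
have sum1 l : (\sum_(k < n) (k == l) = 1)%N.
  by rewrite (bigD1 l) //= eqxx big1 // => k /negbTE ->.
rewrite -[in LHS](sum1 i) -[in RHS](sum1 j) -!big_split /=.
apply: eq_bigr => k _; rewrite ffunE subnK //.
by case: (k =P i) => // ->; rewrite (leq_trans eta_i) ?leq_addr.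
Qed.

Lemma occ_move (n m : nat) (eta : Omega n m) (i j : 'I_n) :
  (0 < occ eta i)%N -> occ (move eta i j) = move_raw (occ eta) i j.
Proof.
move=> eta_i; rewrite /occ /move insubdK // unfold_in /=.
by rewrite move_raw_sum //; exact: (valP eta).
Qed.

Definition zrp_generator (R : realType) (n m : nat)
    (f : Omega n m -> R) (eta : Omega n m) : R :=
  n%:R^-1 * \sum_(i < n) \sum_(j < n)
    (if (0 < occ eta i)%N then f (move eta i j) - f eta else 0).

(* e^(t L) f, as a pointwise exponential series; it converges whenever L is
   bounded for the supremum norm and f is bounded. *)
Definition semigroup (R : realType) (S : Type)
    (L : (S -> R) -> S -> R) (t : R) (f : S -> R) (x : S) : R :=
  limn (series (fun k => t ^+ k / k`!%:R * iter k L f x)).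

Definition transition (R : realType) (S : eqType)
    (L : (S -> R) -> S -> R) (t : R) (x y : S) : R :=
  semigroup L t (fun z => (z == y)%:R) x.

(* X is a continuous-time Markov process on the discrete space S, with bounded
   generator L, cadlag paths and X_0 = x0 almost surely. The time parameter is
   a real number, but only t >= 0 is meaningful. *)
Record is_markov_process (R : realType) (d : measure_display)
    (W : measurableType d) (P : probability W R) (S : eqType)
    (L : (S -> R) -> S -> R) (x0 : S) (X : R -> W -> S) : Prop := {
  mp_measurable : forall (t : R) (x : S), 0 <= t ->
    measurable [set w | X t w = x] ;
  mp_right_continuous : forall (w : W) (t : R), 0 <= t ->
    \forall s \near t^'+, X s w = X t w ;
  mp_left_limit : forall (w : W) (t : R), 0 < t ->
    exists x : S, \forall s \near t^'-, X s w = x ;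
  mp_init : P [set w | X 0 w = x0] = 1%E ;
  mp_fdd : forall (k : nat) (t : nat -> R) (x : nat -> S),
    0 <= t 0%N -> {homo t : i j / (i <= j)%N >-> i <= j} ->
    P [set w | forall j : nat, (j <= k)%N -> X (t j) w = x j] =
    (P [set w | X (t 0%N) w = x 0%N] *
      (\prod_(j < k) transition L (t j.+1 - t j) (x j) (x j.+1))%:E)%E }.

Definition is_zero_range_process (R : realType) (d : measure_display)
    (W : measurableType d) (P : probability W R) (n m : nat)
    (eta0 : Omega n m) (X : R -> W -> Omega n m) : Prop :=
  is_markov_process P (@zrp_generator R n m) eta0 X.

(* The n-th random variable lives on its own probability space. *)
Definition cvg_in_probability (R : realType) (d : nat -> measure_display)
    (W : forall n, measurableType (d n)) (P : forall n, probability (W n) R)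
    (Y : forall n, W n -> R) (c : R) : Prop :=
  (forall n, measurable_fun [set: W n] (Y n)) /\
  forall eps : R, 0 < eps ->
    (fun n => P n [set w | eps <= `|Y n w - c|]) @ \oo --> (0 : \bar R)%E.

(* Main.v *)
Require Import Defs.
From mathcomp Require Import all_boot all_order all_algebra.
From mathcomp Require Import all_classical all_reals all_analysis.
From mathcomp Require Import measurable_realfun.
From mathcomp Require Import ring lra.

(** The proof turns the local equilibrium of the small sites into an exact
    energy identity, and then only needs supermartingales.

    With [N] sites and [m] particles write [x_i = eta_i / N] and let [b] be the
    fraction of empty sites.  On the time scale [N] a nonempty site [i] has
    drift [- b], an empty one has drift [1 - b], and the energy
    [Q = sum_i x_i ^ 2] has drift [2 (1 - b (1 + m / N))] up to [O(1/N)]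
    ([generator_density], [generator_energy]).  As the last drift is affine in
    [b], the function
    [clock = (s + Q(eta^0) / 2 - Q(eta) / 2) / (1 + m / N)] of the time [s] and
    of the configuration has drift [b], exactly so once explicit corrections of
    order [1/N] are included: it reads the fast quantity [int b] off the slow
    variables.  Each large site should then follow the decreasing path
    [u_i - clock] reflected at [0], that is [x_i = (u_i - clock)_+].  Indeed
    [(x_i - (u_i - clock)_+) ^ 2] has nonpositive drift up to [O(1/N)]: as long
    as [clock < u_i] the drifts of [x_i] and of its target cancel, except for the
    reflection at [0], which only acts when [x_i] is not above its target; after
    that the target is [0] and [x_i] decreases; and the kink of the positive part
    contributes with the right sign, by convexity.  The same holds for
    [(- clock)_+ ^ 2], and the drift of [sum_(i >= K) x_i ^ 3] is [O(1/N)]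
    ([lyapunov_zero_range]).

    A maximal inequality ([lyapunov_maximal_inequality]) makes these quantities
    small uniformly in [0 <= s <= T], outside an event of small probability.
    The finite-dimensional laws give a discrete maximal inequality along a grid
    of mesh [h], in which each step costs its drift and an error [O(h ^ 2)]; then
    [h] tends to [0] along dyadic grids, the paths being right-continuous.

    On the good event the energy is close to [sum_i (u_i - clock)_+ ^ 2], the
    cubes controlling the tail of the sum.  Inserted in the definition of
    [clock], this reads [G(clock_s) ~ G(0) + s] with
    [G(w) = sum_i (u_i - w)_+ ^ 2 / 2 + (1 + rho) w].  As
    [G' = 1 + rho - sum_i (u_i - w)_+ >= 1] on [w >= 0], the clock is close to
    the solution [omega] of [G(omega(s)) = G(0) + s] ([stability]).  That
    solution has derivative [1 / (1 + rho - sum_i (u_i - omega)_+)], so that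
    [v_i = (u_i - omega)_+] solves the integral equation
    ([omega_integral]). *)

Set Implicit Arguments.
Unset Strict Implicit.
Unset Printing Implicit Defensive.

Import Order.TTheory GRing.Theory Num.Theory.
Import numFieldNormedType.Exports.

Local Open Scope classical_set_scope.
Local Open Scope ring_scope.

(** * Bounded generators and their semigroups *)

Lemma eq_le_imp (R : realType) (a b : R) : a = b -> a <= b.
Proof. by move=> ->. Qed.

Definition linear_op (R : realType) (S : Type) (L : (S -> R) -> S -> R) :=
  forall (a : R) (f g : S -> R) (x : S),
    L (fun y => a * f y + g y) x = a * L f x + L g x.

Definition bounded_op (R : realType) (S : Type) (L : (S -> R) -> S -> R)
    (c : R) :=
  forall (f : S -> R) (B : R), (forall y, `|f y| <= B) ->
    forall x, `|L f x| <= c * B.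

Section semigroup.
Context (R : realType) (S : eqType) (L : (S -> R) -> S -> R) (c : R)
  (L_lin : linear_op L) (L_bdd : bounded_op L c).

Lemma bounded_op_iter (f : S -> R) (B : R) (k : nat) :
  (forall y, `|f y| <= B) -> forall x, `|iter k L f x| <= c ^+ k * B.
Proof.
move=> fB; elim: k => [|k IH] x /=; first by rewrite expr0 mul1r.
by rewrite exprS -mulrA; exact: L_bdd.
Qed.

Lemma linear_op_ext (f g : S -> R) : f =1 g -> L f =1 L g.
Proof. by move=> /funext ->. Qed.

Lemma linear_op0 x : L (fun=> 0) x = 0.
Proof.
have := L_lin (- 1) (fun=> 0) (fun=> 0) x.
under [X in L X]eq_fun do rewrite mulr0 addr0.
by move=> ->; rewrite mulN1r addNr.
Qed.

Lemma linear_opZ a f x : L (fun y => a * f y) x = a * L f x.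
Proof.
have := L_lin a f (fun=> 0) x.
by under [X in L X]eq_fun do rewrite addr0; rewrite linear_op0 addr0.
Qed.

Lemma linear_opD f g x : L (fun y => f y + g y) x = L f x + L g x.
Proof.
have := L_lin 1 f g x.
by under [X in L X]eq_fun do rewrite mul1r; rewrite mul1r.
Qed.

Lemma linear_op_sum (I : Type) (r : seq I) (a : I -> R) (f : I -> S -> R) x :
  L (fun y => \sum_(i <- r) a i * f i y) x = \sum_(i <- r) a i * L (f i) x.
Proof.
elim: r => [|i r IH].
  rewrite big_nil -[RHS](linear_op0 x); apply: linear_op_ext => y.
  by rewrite big_nil.
rewrite big_cons -IH -L_lin; apply: linear_op_ext => y.
by rewrite big_cons.
Qed.

Lemma linear_op_iter (I : Type) (r : seq I) (a : I -> R) (f : I -> S -> R)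
    (k : nat) x :
  iter k L (fun y => \sum_(i <- r) a i * f i y) x =
  \sum_(i <- r) a i * iter k L (f i) x.
Proof.
elim: k x => //= k IH x.
by rewrite (linear_op_ext IH) linear_op_sum.
Qed.

Lemma bounded_op_ge0 (x : S) : 0 <= c.
Proof.
rewrite -(mulr1 c); apply: le_trans (normr_ge0 _) (L_bdd (f := fun=> 0) _ x).
by move=> y; rewrite normr0.
Qed.

Lemma semigroup_cvg (t : R) (f : S -> R) (B : R) (x : S) :
  0 <= t -> (forall y, `|f y| <= B) ->
  cvgn (series (fun k => t ^+ k / k`!%:R * iter k L f x)).
Proof.
move=> t0 fB; have c0 := bounded_op_ge0 x.
have B0 : 0 <= B := le_trans (normr_ge0 _) (fB x).
apply: normed_cvg.
apply: (@series_le_cvg _ _ (B *: exp_coeff (t * c))).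
- by move=> n; exact: normr_ge0.
- by move=> n; rewrite mulr_ge0 // exp_coeff_ge0 // mulr_ge0.
- move=> n; rewrite /= normrM ger0_norm ?divr_ge0 ?exprn_ge0 //.
  rewrite (le_trans (ler_wpM2l _ (bounded_op_iter n fB x))) //.
    by rewrite divr_ge0 ?exprn_ge0.
  rewrite -[leRHS]/(B * ((t * c) ^+ n / n`!%:R)) exprMn le_eqVlt.
  by apply/orP; left; apply/eqP; ring.
- exact: is_cvg_seriesZ (is_cvg_series_exp_coeff _).
Qed.

(** The transition function is defined from the semigroup acting on indicators;
    finiteness of the state space and linearity recover the action on every
    function. *)
Lemma semigroup_transition (E : seq S) (t : R) (g : S -> R) (x : S) :
  (forall y, y \in E) -> uniq E -> 0 <= t ->
  semigroup L t g x = \sum_(y <- E) transition L t x y * g y.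
Proof.
move=> inE uE t0.
have gE : g = fun y => \sum_(z <- E) g z * (y == z)%:R.
  apply/funext => y; rewrite (bigD1_seq y) //= eqxx mulr1 big1 ?addr0 //.
  by move=> z /negbTE zy; rewrite eq_sym zy mulr0.
have cv z : cvgn (series (fun k => t ^+ k / k`!%:R *
     iter k L (fun y => (y == z)%:R) x)).
  apply: (@semigroup_cvg _ _ 1) => // y.
  by case: (y == z); rewrite ?normr1 ?normr0.
rewrite /semigroup {1}gE.
apply: cvg_lim => //.
rewrite [X in X @ _ --> _](_ : _ = fun n => \sum_(z <- E) g z *
   series (fun k => t ^+ k / k`!%:R * iter k L (fun y => (y == z)%:R) x) n).
  under [X in _ --> X]eq_bigr do rewrite mulrC.
  by apply: cvg_big => [|z _]; [exact: add_continuous|exact: cvgMr (cv z)].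
apply/funext => n; rewrite /series /=.
under [RHS]eq_bigr do rewrite mulr_sumr.
rewrite exchange_big /=; apply: eq_bigr => k _.
rewrite linear_op_iter mulr_sumr; apply: eq_bigr => z _.
by rewrite mulrCA.
Qed.

(** The remainder is uniform in the state and quadratic in [t], so that the errors
    of [n] steps of length [T / n] add up to [O(1/n)]. *)
Lemma semigroup_first_order (t : R) (f : S -> R) (B : R) (x : S) :
  0 <= t <= 1 -> (forall y, `|f y| <= B) ->
  `|semigroup L t f x - (f x + t * L f x)| <= t ^+ 2 * (c ^+ 2 * expR c * B).
Proof.
move=> /andP[t0 t1] fB; have c0 := bounded_op_ge0 x.
have B0 : 0 <= B := le_trans (normr_ge0 _) (fB x).
pose a k := t ^+ k / k`!%:R * iter k L f x.
have cva : cvgn (series a) := semigroup_cvg t0 fB.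
have cvb : (fun n => series a n.+2 - (f x + t * L f x)) @ \oo -->
    semigroup L t f x - (f x + t * L f x).
  apply: cvgB; last exact: cvg_cst.
  rewrite [X in X @ _](_ : _ = (fun n => series a (n + 2)%N)); last first.
    by apply/funext => n; rewrite addn2.
  by rewrite (cvg_shiftn 2).
apply: (ler_cvg_to (cvg_norm cvb) (@cvg_cst _ _ _ _ _)); near=> n.
have -> : series a n.+2 - (f x + t * L f x) = \sum_(0 <= k < n) a k.+2.
  rewrite /series /= !big_nat_recl // {1 2}/a /= expr0 expr1 fact0.
  by rewrite invr1 !mulr1 mul1r; ring.
apply: le_trans (ler_norm_sum _ _ _) _.
apply: (@le_trans _ _ (\sum_(0 <= k < n) t ^+ 2 * (c ^+ 2 * exp_coeff c k * B))).
  apply: ler_sum => k _; rewrite normrM ger0_norm ?divr_ge0 ?exprn_ge0 //.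
  apply: le_trans (ler_wpM2l _ (bounded_op_iter k.+2 fB x)) _.
    by rewrite divr_ge0 ?exprn_ge0.
  rewrite /exp_coeff /= -addn2 !exprD.
  have -> : t ^+ k * t ^+ 2 / (k + 2)`!%:R * (c ^+ k * c ^+ 2 * B) =
     (t ^+ 2 * (c ^+ 2 * c ^+ k * B)) * (t ^+ k * (k + 2)`!%:R^-1) by ring.
  have -> : t ^+ 2 * (c ^+ 2 * (c ^+ k / k`!%:R) * B) =
     (t ^+ 2 * (c ^+ 2 * c ^+ k * B)) * k`!%:R^-1 by ring.
  apply: ler_wpM2l; first by rewrite !mulr_ge0 ?exprn_ge0.
  apply: le_trans (ler_piMl _ _) _; rewrite ?invr_ge0 ?exprn_ile1 //.
  by rewrite lef_pV2 ?posrE ?ltr0n ?fact_gt0 // ler_nat leq_fact ?leq_addr.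
rewrite -mulr_sumr -mulr_suml -mulr_sumr.
apply: ler_wpM2l; rewrite ?exprn_ge0 //; apply: ler_wpM2r => //.
apply: ler_wpM2l; rewrite ?exprn_ge0 //.
apply: (@nondecreasing_cvgn_le _ (series (exp_coeff c))).
  by apply: nondecreasing_series => i _ _; exact: exp_coeff_ge0.
exact: is_cvg_series_exp_coeff.
Unshelve. all: by end_near. Qed.

End semigroup.

(** * The Markov property along a discrete skeleton *)

Section markov_property.
Context (R : realType) (d : measure_display) (W : measurableType d)
  (P : probability W R) (S : choiceType) (L : (S -> R) -> S -> R) (x0 : S)
  (X : R -> W -> S) (E : seq S).
Context (X_markov : is_markov_process P L x0 X).
Context (inE : forall y, y \in E) (uE : uniq E).

Local Notation pr A := (fine (P A)).

Lemma measurable_state (t : R) (B : set S) :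
  0 <= t -> measurable [set w | B (X t w)].
Proof.
move=> t0.
have -> : [set w | B (X t w)] = \bigcup_(x in [set` E] `&` B) [set w | X t w = x].
  apply/seteqP; split => [w Bw|w [x [_ Bx] /= ->]] //.
  by exists (X t w) => //; split => //=; exact: inE.
apply: fin_bigcup_measurable => [|x _]; last exact: (mp_measurable X_markov).
exact/finite_setIl/finite_seq.
Qed.

Lemma pr_ge0 A : 0 <= pr A. Proof. exact: fine_ge0. Qed.

Lemma pr_le1 A : measurable A -> pr A <= 1.
Proof.
by move=> mA; rewrite -(@fine1 R) fine_le ?fin_num_measure ?probability_le1.
Qed.

Lemma pr_fin A : measurable A -> P A = (pr A)%:E.
Proof. by move=> mA; rewrite fineK // fin_num_measure. Qed.

Lemma pr_split (A : set W) (t : R) : measurable A -> 0 <= t ->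
  pr A = \sum_(x <- E) pr (A `&` [set w | X t w = x]).
Proof.
move=> mA t0.
have m_ x : measurable (A `&` [set w | X t w = x]).
  exact: measurableI mA (mp_measurable X_markov x t0).
have -> : P A = (\sum_(x <- E) P (A `&` [set w | X t w = x]))%E.
  rewrite -[in LHS](_ : \bigcup_(x in [set` E])
    (A `&` [set w | X t w = x]) = A); last first.
    apply/seteqP; split => [w [x _ []] //|w Aw].
    by exists (X t w) => //=; exact: inE.
  rewrite measure_fin_bigcup //; first by rewrite -fsbig_seq.
  by move=> x y _ _ [w [[_ <-] [_ <-]]].
elim: E => [|x r IH]; first by rewrite !big_nil.
rewrite !big_cons fineD ?IH ?fin_num_measure // sum_fin_num.
by apply/allP => _ /mapP[y _ ->]; apply: fin_num_measure; exact: m_.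
Qed.

Lemma pr_split_cond (A : set W) (B : pred S) (t : R) : measurable A -> 0 <= t ->
  pr (A `&` [set w | B (X t w)]) =
  \sum_(x <- E | B x) pr (A `&` [set w | X t w = x]).
Proof.
move=> mA t0.
rewrite (pr_split (t := t)) //; last first.
  by apply: measurableI => //; exact: (@measurable_state t [set x | B x]).
rewrite [RHS]big_mkcond /=; apply: eq_bigr => x _; case: ifPn => Bx.
  congr (pr _); apply/seteqP; split => w /=; first by move=> [[]].
  by move=> [Aw Xw]; rewrite Xw.
rewrite (_ : _ `&` _ = set0) ?measure0 //.
apply/seteqP; split => w //= [[_ BX] Xw].
by move: BX; rewrite Xw (negbTE Bx).
Qed.

Context (h : R).
Context (h_ge0 : 0 <= h).

Let Y (j : nat) (w : W) : S := X (j%:R * h) w.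

Let jh_ge0 j : 0 <= j%:R * h. Proof. exact: mulr_ge0. Qed.

Lemma measurable_forall_lt (k : nat) (A : nat -> set W) :
  (forall j, measurable (A j)) -> measurable [set w | forall j, (j < k)%N -> A j w].
Proof.
move=> mA; rewrite (_ : [set w | _] = \bigcap_(j in [set j | (j < k)%N]) A j) //.
by apply: bigcap_measurableType => j _; exact: mA.
Qed.

Let cyl (B : nat -> pred S) (k : nat) : set W :=
  [set w | forall j, (j < k)%N -> B j (Y j w)].

Let measurable_cyl B k : measurable (cyl B k).
Proof.
apply: measurable_forall_lt => j.
exact: (measurable_state (fun x => B j x) (jh_ge0 j)).
Qed.

Lemma cyl_fdd (x : nat -> S) k :
  pr (cyl (fun j => pred1 (x j) : pred S) k.+1) =
  pr [set w | Y 0 w = x 0%N] * \prod_(j < k) transition L h (x j) (x j.+1).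
Proof.
have t_homo : {homo (fun j => j%:R * h) : i j / (i <= j)%N >-> i <= j}.
  by move=> i j ij; rewrite ler_wpM2r // ler_nat.
have cylE : cyl (fun j => pred1 (x j) : pred S) k.+1 =
    [set w | forall j, (j <= k)%N -> X (j%:R * h) w = x j].
  by apply/seteqP; split => w Yw j /Yw /eqP.
rewrite cylE; have -> := mp_fdd X_markov (t := fun j => j%:R * h) k x (jh_ge0 0) t_homo.
rewrite fineM //; last first.
  apply: fin_num_measure; exact: (mp_measurable X_markov).
congr (_ * _); apply: eq_bigr => j _.
by rewrite -mulrBl -natrB // subSnn mul1r.
Qed.

(** Summing over the value at one time [l] trades a set constraint at [l] for a
    point constraint. *)
Lemma cyl_split (B : nat -> pred S) (l n : nat) : (l < n)%N ->
  pr (cyl B n) =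
  \sum_(z <- E | B l z)
    pr (cyl (fun j => if j == l then (pred1 z : pred S) else B j) n).
Proof.
move=> ln.
(* [A] leaves the state at time [l] free. *)
pose A := cyl (fun j => if j == l then (predT : pred S) else B j) n.
have -> : cyl B n = A `&` [set w | B l (X (l%:R * h) w)].
  apply/seteqP; split => w /=.
    by move=> Bw; split; [move=> j jn; case: ifP => // _; exact: Bw|exact: Bw].
  move=> [Aw Bl] j jn; have := Aw j jn.
  by case: eqP => [->|].
have mA : measurable A := measurable_cyl _ _.
rewrite pr_split_cond //; apply: eq_bigr => z _; congr (pr _).
apply/seteqP; split => w /=.
  move=> [Aw Yl] j jn; have := Aw j jn.
  by case: eqP => [-> _|//]; rewrite /= /Y Yl.
move=> Bw; split; last by have := Bw l ln; rewrite eqxx => /eqP.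
by move=> j jn; have := Bw j jn; case: eqP.
Qed.

(** The law of the skeleton is only given through finite sequences of states;
    the condition on each past state is enlarged from a point to a set by
    summing over its values, one time after the other. *)
Lemma markov_one_step (B : nat -> pred S) (k : nat) (x y : S) :
  pr (cyl B k `&` [set w | Y k w = x] `&` [set w | Y k.+1 w = y]) =
  pr (cyl B k `&` [set w | Y k w = x]) * transition L h x y.
Proof.
pose D l (z : nat -> S) (j : nat) : pred S :=
  if (j < l)%N then B j else (pred1 (z j) : pred S).
have key l (z : nat -> S) : (l <= k)%N ->
  pr (cyl (D l z) k.+2) = pr (cyl (D l z) k.+1) * transition L h (z k) (z k.+1).
  elim: l z => [z _|l IH z lk].
    have D0 n : cyl (D 0%N z) n = cyl (fun j => pred1 (z j) : pred S) n.
      by apply/seteqP; split => w Bw j /Bw.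
    by rewrite !D0 !cyl_fdd big_ord_recr /= mulrA.
  rewrite (@cyl_split _ l k.+2) ?(@cyl_split _ l k.+1) ?ltnS ?(ltnW lk) //;
    last by rewrite (leq_trans (ltnW lk)).
  rewrite big_distrl /=; apply: eq_bigr => a _.
  pose z' j := if j == l then a else z j.
  have DE : (fun j => if j == l then (pred1 a : pred S) else D l.+1 z j) = D l z'.
    apply/funext => j; rewrite /D /z' ltnS leq_eqVlt.
    by case: eqP => [->|_]; rewrite ?ltnn.
  rewrite DE IH ?(ltnW lk) // /z' (gtn_eqF lk) gtn_eqF //.
  by rewrite (leq_trans lk).
pose z j := if j == k then x else y.
have cyl1 : cyl (D k z) k.+1 = cyl B k `&` [set w | Y k w = x].
  apply/seteqP; split => w /=.
    move=> Dw; split=> [j jk|]; first by have := Dw j (ltnW jk); rewrite /D jk.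
    by have := Dw k (leqnn _); rewrite /D ltnn /z eqxx => /eqP.
  move=> [Bw Yx] j; rewrite ltnS leq_eqVlt /D => /orP[/eqP ->|jk].
    by rewrite ltnn /z eqxx; exact/eqP.
  by rewrite jk; exact: Bw.
have cyl2 : cyl (D k z) k.+2 =
    cyl B k `&` [set w | Y k w = x] `&` [set w | Y k.+1 w = y].
  rewrite -cyl1; apply/seteqP; split => w /=.
    move=> Dw; split=> [j jk|]; first by apply: Dw; rewrite ltnW.
    by have := Dw k.+1 (leqnn _); rewrite /D ltnNge leqnSn /z gtn_eqF // => /eqP.
  move=> [Dw Yy] j; rewrite ltnS leq_eqVlt => /orP[/eqP ->|jk].
    by rewrite /D ltnNge leqnSn /z gtn_eqF //; exact/eqP.
  exact: Dw.
by have := key k z (leqnn k); rewrite cyl1 cyl2 /z eqxx gtn_eqF.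
Qed.

(** Optional stopping at the first index where [f] reaches the level [a].  The
    hypothesis on [f] may use that transition probabilities are nonnegative and
    sum to [1], although the exponential series does not show it: a state that
    the chain visits with positive probability gets it from the process. *)
Lemma discrete_maximal_inequality (f : nat -> S -> R) (a e : R) (n : nat) :
  0 <= a -> 0 <= e -> (forall j x, 0 <= f j x) ->
  (forall j x, (j < n)%N ->
    (forall y, 0 <= transition L h x y) ->
    \sum_(y <- E) transition L h x y = 1 ->
    \sum_(y <- E) transition L h x y * f j.+1 y <= f j x + e) ->
  a * pr [set w | exists2 j, (j <= n)%N & a <= f j (Y j w)] <=
  f 0%N x0 + n%:R * e.
Proof.
move=> a0 e0 f0 fS.
pose B j : pred S := fun x => f j x < a.
pose q j x := pr (cyl B j `&` [set w | Y j w = x]).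
have mYq j x : measurable (cyl B j `&` [set w | Y j w = x]).
  exact: measurableI (measurable_cyl _ _) (mp_measurable X_markov _ _).
have q0 j x : 0 <= q j x by exact: pr_ge0.
pose M j := \sum_(x <- E) f j x * q j x + a * (1 - pr (cyl B j)).
have qE j : pr (cyl B j) = \sum_(x <- E) q j x.
  by rewrite (pr_split (measurable_cyl _ _) (jh_ge0 j)).
have cylS j : cyl B j.+1 = cyl B j `&` [set w | B j (X (j%:R * h) w)].
  apply/seteqP; split => w /=.
    by move=> Bw; split=> [i ij|]; apply: Bw => //; rewrite ltnW.
  by move=> [Bw Bj] i; rewrite ltnS leq_eqVlt => /orP[/eqP ->//|]; exact: Bw.
have qS j : pr (cyl B j.+1) = \sum_(x <- E | B j x) q j x.
  by rewrite cylS (pr_split_cond _ (measurable_cyl _ _) (jh_ge0 j)).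
have qSy j y : q j.+1 y = \sum_(x <- E | B j x) q j x * transition L h x y.
  rewrite /q cylS setIAC.
  rewrite (pr_split_cond _ _ (jh_ge0 j)); last first.
    exact: measurableI (measurable_cyl _ _) (mp_measurable X_markov _ _).
  by apply: eq_bigr => x _; rewrite setIAC markov_one_step.
(* On a state of positive mass the transition probabilities are ratios of
   probabilities of events. *)
have step j x : (j < n)%N ->
    \sum_(y <- E) f j.+1 y * (q j x * transition L h x y) <= q j x * (f j x + e).
  move=> jn.
  under eq_bigr do rewrite mulrCA [f _ _ * _]mulrC.
  rewrite -mulr_sumr.
  have [->|qn0] := eqVneq (q j x) 0; first by rewrite !mul0r.
  have qgt0 : 0 < q j x by rewrite lt_neqAle eq_sym qn0 q0.
  apply: ler_wpM2l => //; apply: fS => // [y|].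
    rewrite -(pmulr_rge0 _ qgt0) /q -markov_one_step; exact: pr_ge0.
  apply: (mulfI qn0); rewrite mulr1 mulr_sumr [RHS]/q.
  rewrite (pr_split (mYq j x) (jh_ge0 j.+1)).
  by apply: eq_bigr => y _; rewrite markov_one_step.
have MS j : (j < n)%N -> M j.+1 <= M j + e.
  move=> jn; rewrite /M qS (qE j).
  have -> : \sum_(x <- E) f j.+1 x * q j.+1 x =
      \sum_(x <- E | B j x) \sum_(y <- E) f j.+1 y * (q j x * transition L h x y).
    under eq_bigr do rewrite qSy mulr_sumr.
    by rewrite exchange_big.
  have le1 : \sum_(x <- E | B j x) \sum_(y <- E)
        f j.+1 y * (q j x * transition L h x y) <=
      \sum_(x <- E | B j x) f j x * q j x + e * \sum_(x <- E | B j x) q j x.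
    rewrite mulr_sumr -big_split /=; apply: ler_sum => x _.
    by apply: le_trans (step j x jn) _; rewrite mulrDr mulrC [e * _]mulrC.
  have le2 : a * \sum_(x <- E | ~~ B j x) q j x <=
      \sum_(x <- E | ~~ B j x) f j x * q j x.
    rewrite mulr_sumr; apply: ler_sum => x; rewrite /B -leNgt => afx.
    exact: ler_wpM2r.
  have le3 : e * \sum_(x <- E | B j x) q j x <= e.
    by rewrite -qS ler_piMr // pr_le1 //; exact: measurable_cyl.
  rewrite [X in _ <= X + _ + _](bigID (B j)) /=.
  rewrite [X in _ <= _ + a * (1 - X) + _](bigID (B j)) /=.
  nra.
have M0 : M 0%N = f 0%N x0.
  have cyl0 : cyl B 0 = setT by apply/seteqP; split.
  have PX0 : pr [set w | X (0%:R * h) w = x0] = 1.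
    by rewrite mul0r (mp_init X_markov).
  rewrite /M cyl0 probability_setT subrr mulr0 addr0 (bigD1_seq x0) //=.
  rewrite /q cyl0 setTI PX0 mulr1 big1 ?addr0 // => x xx0.
  rewrite setTI (_ : pr _ = 0) ?mulr0 //.
  apply/eqP; rewrite eq_le pr_ge0 andbT.
  have mX z := mp_measurable X_markov z (jh_ge0 0).
  rewrite -(lerD2r 1) add0r -[X in _ + X <= _]PX0 -fineD ?fin_num_measure //.
  rewrite -measureU //; last first.
    apply/seteqP; split => w //= [Yx Yx0].
    by move: xx0; rewrite -Yx -Yx0 /Y eqxx.
  by apply: pr_le1; exact: measurableU.
have Mle k : (k <= n)%N -> M k <= f 0%N x0 + k%:R * e.
  elim: k => [_|k IH kn]; first by rewrite M0 mul0r addr0.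
  apply: le_trans (MS k kn) _; rewrite -natr1 mulrDl mul1r addrA lerD2r.
  by apply: IH; exact: ltnW.
have exC : [set w | exists2 j, (j <= n)%N & a <= f j (Y j w)] = ~` cyl B n.+1.
  apply/seteqP; split => w /=.
    by move=> [j jn afj] /(_ j jn); rewrite /B ltNge afj.
  move=> /existsNP[j /not_implyP[jn /negP]]; rewrite /B -leNgt.
  by exists j.
rewrite exC probability_setC; last exact: measurable_cyl.
rewrite (pr_fin (measurable_cyl _ _)) -EFinB /=.
rewrite qS; apply: le_trans (Mle n (leqnn n)); rewrite /M qE.
rewrite [X in a * (1 - X) <= _](_ : _ = \sum_(x <- E) q n x -
  \sum_(x <- E | ~~ B n x) q n x); last first.
  by rewrite [in RHS](bigID (B n)) /= addrK.
have le2 : a * \sum_(x <- E | ~~ B n x) q n x <= \sum_(x <- E) f n x * q n x.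
  rewrite mulr_sumr [leRHS](bigID (B n)) /= -[leLHS]add0r; apply: lerD.
    by apply: sumr_ge0 => x _; rewrite mulr_ge0.
  apply: ler_sum => x; rewrite /B -leNgt => afx.
  exact: ler_wpM2r.
nra.
Qed.

End markov_property.

(** * A maximal inequality in continuous time *)

(** An interval to the right of [t] contains a point of every dyadic grid of mesh
    smaller than its length. *)
Lemma dyadic_right_dense (R : realType) (T t : R) (Q : R -> Prop) :
  0 <= t < T -> (\forall s \near t^'+, Q s) ->
  exists l j : nat, (j <= 2 ^ l)%N /\ Q (j%:R * (T / (2 ^ l)%:R)).
Proof.
move=> /andP[t0 tT] /nbhs_ballP[r /= r0 rQ].
have T0 : 0 < T by exact: le_lt_trans tT.
(* [T / r < 2 ^ l], so the mesh is smaller than [r]. *)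
pose l := (Num.truncn (T / r)).+1.
have p0 : 0 < (2 ^ l)%:R :> R by rewrite ltr0n expn_gt0.
pose h := T / (2 ^ l)%:R.
have h0 : 0 < h by rewrite divr_gt0.
have hr : h < r.
  rewrite /h ltr_pdivrMr // mulrC -ltr_pdivrMr //.
  apply: lt_trans (truncnS_gt _) _.
  by rewrite ltr_nat ltn_expl.
pose j := (Num.truncn (t / h)).+1.
have jh : t < j%:R * h by rewrite -ltr_pdivrMr // truncnS_gt.
have jh' : j%:R * h <= t + h.
  rewrite /j -natr1 mulrDl mul1r lerD2r -ler_pdivlMr // truncn_le.
  by rewrite divr_ge0 // ltW.
exists l, j; split.
  rewrite /j truncn_lt_nat ?divr_ge0 // ?ltW //.
  rewrite ltr_pdivrMr // /h mulrCA mulfV ?mulr1 //.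
apply: (rQ (j%:R * h)) => //=.
rewrite /ball /= ltr_norml; apply/andP; split; last by lra.
by lra.
Qed.

Section maximal_inequality.
Context (R : realType) (d : measure_display) (W : measurableType d)
  (P : probability W R) (S : choiceType) (L : (S -> R) -> S -> R) (x0 : S)
  (X : R -> W -> S) (E : seq S) (cL : R).
Context (X_markov : is_markov_process P L x0 X).
Context (inE : forall y, y \in E) (uE : uniq E).
Context (L_lin : linear_op L) (L_bdd : bounded_op L cL).

(** The majorant [F t x + g t x y + h * c t x + C * h ^+ 2] of [F (t + h) y]
    replaces differentiability: it only asks [F] to be semi-concave, which
    accommodates the kink of a positive part, and [L (g t x) x + c t x] is then
    an upper bound of the drift of [F] at [(t, x)].  The bound [C] on [g] has to
    be uniform in time for the errors of all steps to be added. *)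
Definition lyapunov (T : R) (F : R -> S -> R) (e : R) : Prop :=
  (forall x, continuous (F^~ x)) /\
  exists (g : R -> S -> S -> R) (c : R -> S -> R) (C : R), 0 <= C /\
    forall (t : R) (x : S), 0 <= t <= T ->
      [/\ g t x x = 0, L (g t x) x + c t x <= e, forall y, `|g t x y| <= C &
          forall (h : R) (y : S), 0 <= h <= 1 ->
            F (t + h) y <= F t x + g t x y + h * c t x + C * h ^+ 2].

(** The jump part is integrated by [semigroup_first_order], applied to the
    majorant, which vanishes at the starting point. *)
Lemma lyapunov_one_step (T : R) (F : R -> S -> R) (e : R) :
  lyapunov T F e -> exists2 K : R, 0 <= K & forall (t h : R) (x : S),
    0 <= t <= T -> 0 <= h <= 1 ->
    (forall y, 0 <= transition L h x y) ->
    \sum_(y <- E) transition L h x y = 1 ->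
    \sum_(y <- E) transition L h x y * F (t + h) y <=
    F t x + (h * e + K * h ^+ 2).
Proof.
move=> [_ [g [c [C [C0 gcC]]]]].
exists (cL ^+ 2 * expR cL * C + C).
  by rewrite addr_ge0 // mulr_ge0 // mulr_ge0 ?expR_ge0 ?sqr_ge0.
move=> t h x tT h01 p0 p1; have [gx Lg gC FS] := gcC t x tT.
have h0 : 0 <= h by case/andP: h01.
apply: (@le_trans _ _ (\sum_(y <- E) transition L h x y *
   (F t x + h * c t x + C * h ^+ 2) + \sum_(y <- E) transition L h x y * g t x y)).
  rewrite -big_split /=; apply: ler_sum => y _; rewrite -mulrDr.
  by apply: ler_wpM2l => //; apply: le_trans (FS h y h01) _; lra.
rewrite -mulr_suml p1 mul1r -(semigroup_transition L_lin L_bdd) //.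
have := semigroup_first_order L_bdd x h01 gC.
rewrite gx add0r ler_norml => /andP[_].
have : h * (L (g t x) x + c t x) <= h * e by exact: ler_wpM2l.
nra.
Qed.

(** The exceedance events along dyadic grids increase with the grid, so the bound
    for a grid passes to their union [B]; the path being right-continuous, an
    exceedance at any time is seen on some grid. *)
Lemma lyapunov_maximal_inequality (T : R) (F : R -> S -> R) (e a : R) :
  0 <= T -> 0 < a -> 0 <= e -> (forall t x, 0 <= F t x) -> lyapunov T F e ->
  exists B : set W, [/\ measurable B, (P B <= ((F 0 x0 + e * T) / a)%:E)%E &
    forall w, ~ B w -> forall t, 0 <= t <= T -> F t (X t w) <= a].
Proof.
move=> T0 a0 e0 F0 FL; have [K K0 step] := lyapunov_one_step FL.
pose h l := T / (2 ^ l)%:R.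
have h_cvg : h @ \oo --> 0.
  rewrite (_ : h = geometric T 2^-1); last first.
    by apply/funext => l; rewrite /h /geometric /= natrX exprVn.
  by apply: cvg_geometric; rewrite ger0_norm ?invr_ge0 // invf_lt1 ?ltr1n.
have p0 l : 0 < (2 ^ l)%:R :> R by rewrite ltr0n expn_gt0.
have h0 l : 0 <= h l by rewrite divr_ge0 // ltW.
pose bad l := [set w | exists2 j, (j <= 2 ^ l)%N &
   a <= F (j%:R * h l) (X (j%:R * h l) w)].
have mbad l : measurable (bad l).
  have -> : bad l = \bigcup_(j in [set j | (j <= 2 ^ l)%N])
     [set w | a <= F (j%:R * h l) (X (j%:R * h l) w)].
    by apply/seteqP; split => [w [j jl aF]|w [j jl aF]]; exists j.
  apply: bigcup_measurable => j _.
  apply: (measurable_state X_markov inE (fun x => a <= F (j%:R * h l) x)).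
  by rewrite mulr_ge0.
exists (\bigcup_l bad l); split; first exact: bigcup_measurable.
- have bad_nd : nondecreasing_seq bad.
    apply/nondecreasing_seqP => l; apply/subsetPset => w [j jl aF].
    exists (j * 2)%N; first by rewrite expnSr leq_mul2r.
    have -> : (j * 2)%:R * h l.+1 = j%:R * h l; last by [].
    by rewrite /h expnSr !natrM; field; rewrite gt_eqF.
  have cvP := @nondecreasing_cvg_mu _ _ _ P bad mbad (bigcup_measurable (fun k _ => mbad k)) bad_nd.
  have cvb : (fun l => ((F 0 x0 + (e * T + K * T * h l)) / a)%:E) @ \oo -->
      ((F 0 x0 + e * T) / a)%:E.
    apply: cvg_EFin; first exact: nearW.
    have -> : (F 0 x0 + e * T) / a = (F 0 x0 + (e * T + K * T * 0)) / a.
      by rewrite mulr0 addr0.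
    apply: cvgMl; apply: cvgD; first exact: cvg_cst.
    by apply: cvgD; [exact: cvg_cst|exact: cvgMr].
  apply: (lee_cvg_to cvP cvb); near=> l.
  have h1 : h l <= 1.
    near: l; apply: (cvgr_le _ h_cvg) => /=; exact: ltr01.
  rewrite /= (pr_fin P (mbad l)) lee_fin ler_pdivlMr // mulrC.
  have := @discrete_maximal_inequality _ _ _ P _ _ _ _ E X_markov inE uE (h l)
    (h0 l) (fun j => F (j%:R * h l)) a (h l * e + K * h l ^+ 2) (2 ^ l) (ltW a0).
  rewrite mul0r /= => /(_ _ _ _) /le_trans; apply => //.
  + by rewrite addr_ge0 // mulr_ge0 // exprn_ge0.
  + move=> j x jl q0 q1.
    have -> : j.+1%:R * h l = j%:R * h l + h l by rewrite -natr1; ring.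
    apply: step => //; last by rewrite h0 h1.
    rewrite mulr_ge0 //= /h mulrA ler_pdivrMr // mulrC ler_wpM2l // ler_nat.
    exact: ltnW.
  + rewrite lerD2l mulrDr /h; apply: eq_le_imp.
    by field; rewrite gt_eqF.
- move=> w Bw t /andP[t0 tT]; rewrite leNgt; apply/negP => aF.
  move: tT; rewrite le_eqVlt => /orP[/eqP tE|tT].
    apply: Bw; exists 0%N => //; exists 1%N => //.
    by rewrite /h expn0 mul1r divr1 -tE ltW.
  suff : exists l j, (j <= 2 ^ l)%N /\ a <= F (j%:R * h l) (X (j%:R * h l) w).
    by move=> [l [j [jl aFj]]]; apply: Bw; exists l => //; exists j.
  apply: (@dyadic_right_dense _ T t (fun s => a <= F s (X s w))); first by rewrite t0.
  have := mp_right_continuous X_markov w t0.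
  have : \forall s \near t^'+, a < F s (X t w).
    apply: cvgr_gt aF; apply: cvg_at_right_filter; exact: FL.1.
  by apply: filterS2 => s aFs ->; exact: ltW.
Unshelve. all: by end_near. Qed.

End maximal_inequality.

(** * Construction of Lyapunov functions *)

(** Expand the square: [x ^+ 2] and [(u - w)_+ ^ 2] have second derivatives
    bounded by [2], and the mixed term [- 2 x' (u - w')_+] is concave in [w']
    since [x' >= 0], so that it lies below its tangent in spite of the kink. *)
Lemma reflected_square_semiconcave (R : realType) (u x w x' w' : R) :
  0 <= x' ->
  (x' - Num.max (u - w') 0) ^+ 2 <= (x - Num.max (u - w) 0) ^+ 2
    + 2 * (x - Num.max (u - w) 0) * (x' - x)
    + 2 * (x - Num.max (u - w) 0) * (w < u)%R%:R * (w' - w)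
    + 2 * (x' - x) ^+ 2 + 2 * (w' - w) ^+ 2.
Proof.
have sq : 0 <= (x' - x - (w' - w)) ^+ 2 := sqr_ge0 _.
have sqw : 0 <= (w' - w) ^+ 2 := sqr_ge0 _.
have sqx : 0 <= (x' - x) ^+ 2 := sqr_ge0 _.
move=> x'0; have [wu|uw] := ltP w u.
  have uw0 : 0 <= u - w by lra.
  rewrite (max_l uw0) mulr1.
  have [wu'|uw'] := leP 0 (u - w').
    by rewrite -subr_ge0; apply: le_trans sq _; apply: eq_le_imp; ring.
  have : 0 <= x' * (w' - u) by apply: mulr_ge0 => //; lra.
  nra.
have uw0 : u - w <= 0 by lra.
rewrite (max_r uw0) mulr0 mul0r addr0.
have [wu'|uw'] := leP 0 (u - w'); last by nra.
have := mulr_ge0 x'0 wu'.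
have : (u - w') ^+ 2 <= (w' - w) ^+ 2.
  rewrite -[leRHS]sqrrN; apply: lerXn2r; rewrite ?nnegrE //; lra.
nra.
Qed.

Section lyapunov_theory.
Context (R : realType) (S : choiceType) (L : (S -> R) -> S -> R)
  (E : seq S) (T : R).
Context (inE : forall y, y \in E) (L_lin : linear_op L).
Context (L_one : forall x, L (fun=> 1) x = 0).

Lemma finite_bounded (f : S -> R) : exists2 B : R, 0 <= B & forall x, `|f x| <= B.
Proof.
exists (\sum_(x <- E) `|f x|); first exact: sumr_ge0.
by move=> x; rewrite (big_rem x) //= lerDl sumr_ge0.
Qed.

Lemma lyapunov0 : lyapunov L T (fun _ _ => 0) 0.
Proof.
split; first by move=> x; exact: cst_continuous.
exists (fun _ _ _ => 0), (fun _ _ => 0), 0; split => // t x _.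
split => //; first by rewrite linear_op0 // addr0.
  by move=> y; rewrite normr0.
by move=> h y _; rewrite mulr0 !addr0 mul0r.
Qed.

Lemma lyapunovD (F G : R -> S -> R) (e f : R) :
  lyapunov L T F e -> lyapunov L T G f ->
  lyapunov L T (fun t x => F t x + G t x) (e + f).
Proof.
move=> [Fc [g [c [C [C0 FL]]]]] [Gc [g' [c' [C' [C'0 GL]]]]].
split; first by move=> x t; apply: cvgD; [exact: Fc|exact: Gc].
exists (fun t x y => g t x y + g' t x y), (fun t x => c t x + c' t x), (C + C').
split=> [|t x tT]; first by rewrite addr_ge0.
have [gx Lg gC FS] := FL t x tT; have [gx' Lg' gC' GS] := GL t x tT; split.
- by rewrite gx gx' addr0.
- by rewrite linear_opD // addrACA lerD.
- by move=> y; rewrite (le_trans (ler_normD _ _)) // lerD.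
- move=> h y h01; apply: le_trans (lerD (FS h y h01) (GS h y h01)) _.
  by apply: eq_le_imp; ring.
Qed.

Lemma lyapunovZ (a : R) (F : R -> S -> R) (e : R) : 0 <= a ->
  lyapunov L T F e -> lyapunov L T (fun t x => a * F t x) (a * e).
Proof.
move=> a0 [Fc [g [c [C [C0 FL]]]]].
split; first by move=> x t; apply: cvgMr; exact: Fc.
exists (fun t x y => a * g t x y), (fun t x => a * c t x), (a * C).
split=> [|t x tT]; first by rewrite mulr_ge0.
have [gx Lg gC FS] := FL t x tT; split.
- by rewrite gx mulr0.
- by rewrite linear_opZ // -mulrDr ler_wpM2l.
- by move=> y; rewrite normrM ger0_norm // ler_wpM2l.
- move=> h y h01; apply: le_trans (ler_wpM2l a0 (FS h y h01)) _.
  by apply: eq_le_imp; ring.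
Qed.

Lemma lyapunov_sum (I : Type) (r : seq I) (Q : pred I)
    (F : I -> R -> S -> R) (e : I -> R) :
  (forall i, Q i -> lyapunov L T (F i) (e i)) ->
  lyapunov L T (fun t x => \sum_(i <- r | Q i) F i t x) (\sum_(i <- r | Q i) e i).
Proof.
move=> FL.
have -> : (fun t x => \sum_(i <- r | Q i) F i t x) =
    \big[(fun f g => fun t x => f t x + g t x)/(fun _ _ => 0)]_(i <- r | Q i) F i.
  apply/funext => t; apply/funext => x.
  by elim/big_rec2 : _ => // i f y _ ->.
elim/big_rec2 : _ => [|i f y Qi fL]; first exact: lyapunov0.
exact: lyapunovD (FL i Qi) fL.
Qed.

Lemma lyapunov_static (V : S -> R) (e : R) :
  (forall x, L V x <= e) -> lyapunov L T (fun=> V) e.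
Proof.
move=> LV; split; first by move=> x; exact: cst_continuous.
have [B B0 VB] := finite_bounded V.
exists (fun _ x y => V y - V x), (fun _ _ => 0), (B + B); split.
  by rewrite addr_ge0.
move=> t x _; split.
- by rewrite subrr.
- have := L_lin (- V x) (fun=> 1) V x.
  rewrite L_one mulr0 add0r addr0 => VE.
  rewrite (_ : L _ x = L V x) // -VE; apply: linear_op_ext => y.
  by rewrite mulr1 addrC.
- by move=> y; rewrite (le_trans (ler_normB _ _)) // lerD.
- move=> h y _; rewrite mulr0 addr0 subrKC lerDl mulr_ge0 ?addr_ge0 //.
  exact: sqr_ge0.
Qed.

(** The path to be reflected at [0] is [u - (w x + k * t)], and [xi] stands for
    its reflection.  The first-order part of the drift is assumed nonpositive,
    and the second-order part is the sum of the quadratic variations of [xi] and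
    [w], whence the weights [2] and [4]; half of the latter absorbs the cross
    term with the time increment. *)
Lemma lyapunov_reflected (xi w : S -> R) (k u e1 e2 : R) :
  (forall x, 0 <= xi x) ->
  (forall x a, (xi x - Num.max (u - a) 0) *
     (L xi x + (a < u)%R%:R * (L w x + k)) <= 0) ->
  (forall x, L (fun y => (xi y - xi x) ^+ 2) x <= e1) ->
  (forall x, L (fun y => (w y - w x) ^+ 2) x <= e2) ->
  lyapunov L T (fun t x => (xi x - Num.max (u - (w x + k * t)) 0) ^+ 2)
    (2 * e1 + 4 * e2).
Proof.
move=> xi0 drift Lxi2 Lw2; split.
  move=> x t; apply: (@continuous_comp _ _ _
    (fun t => xi x - Num.max (u - (w x + k * t)) 0) (fun a => a ^+ 2));
    last exact: exprn_continuous.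
  apply: cvgB; first exact: cvg_cst.
  apply: (@continuous_max _ _ (fun t => u - (w x + k * t)) (fun=> 0));
    last exact: cvg_cst.
  apply: cvgB; first exact: cvg_cst.
  by apply: cvgD; [exact: cvg_cst|apply: cvgMr; exact: cvg_id].
have [B B0 xiB] := finite_bounded xi; have [D D0 wD] := finite_bounded w.
pose z t x := xi x - Num.max (u - (w x + k * t)) 0.
pose I t x : R := (w x + k * t < u)%R%:R.
pose g t x y := 2 * z t x * (xi y - xi x) + 2 * z t x * I t x * (w y - w x)
   + 2 * (xi y - xi x) ^+ 2 + 4 * (w y - w x) ^+ 2.
pose Z := B + (`|u| + D + `|k| * `|T|).
pose C' := 2 * Z * (B + B) + 2 * Z * 1 * (D + D) + 2 * (B + B) ^+ 2
   + 4 * (D + D) ^+ 2.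
pose C := C' + 4 * k ^+ 2.
have Z0 : 0 <= Z by rewrite !addr_ge0 // mulr_ge0.
have C'0 : 0 <= C'.
  have sq (a : R) : 0 <= 2 * a ^+ 2 by rewrite mulr_ge0 // sqr_ge0.
  have sq' (a : R) : 0 <= 4 * a ^+ 2 by rewrite mulr_ge0 // sqr_ge0.
  by do 3 (apply: addr_ge0 => //); rewrite !mulr_ge0 // addr_ge0.
have k2 : 0 <= 4 * k ^+ 2 by rewrite mulr_ge0 // sqr_ge0.
exists g, (fun t x => 2 * z t x * I t x * k), C; split.
  exact: addr_ge0.
move=> t x /andP[t0 tT]; split.
- by rewrite /g !subrr expr0n /= !mulr0 !addr0.
- have LgE : L (g t x) x = 2 * z t x * L xi x + 2 * z t x * I t x * L w x
     + 2 * L (fun y => (xi y - xi x) ^+ 2) x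
     + 4 * L (fun y => (w y - w x) ^+ 2) x.
    have cst a : L (fun=> a) x = 0.
      rewrite -(mulr0 a) -(L_one x) -linear_opZ //; apply: linear_op_ext => y.
      by rewrite mulr1.
    have Lsub a (f : S -> R) : L (fun y => a * (f y - f x)) x = a * L f x.
      rewrite linear_opZ // -[in RHS](addr0 (L f x)) -(cst (- f x)).
      by rewrite -linear_opD.
    by rewrite /g !linear_opD // !Lsub !linear_opZ.
  have := drift x (w x + k * t); rewrite -/(z t x) -/(I t x) => dr.
  have := Lxi2 x; have := Lw2 x; rewrite LgE; nra.
- move=> y.
  have zZ : `|z t x| <= Z.
    have max_le (b : R) : `|Num.max b 0| <= `|b|.
      by rewrite /Order.max; case: ifP => _; rewrite ?normr0.
    apply: le_trans (ler_normB _ _) (lerD (xiB x) _).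
    apply: le_trans (max_le _) _; apply: le_trans (ler_normB _ _) _.
    rewrite -addrA lerD2l; apply: le_trans (ler_normD _ _) (lerD (wD x) _).
    rewrite normrM; apply: ler_wpM2l => //.
    by rewrite (ger0_norm t0) ger0_norm // (le_trans t0).
  have I1 : `|I t x| <= 1 by rewrite /I; case: (_ < _); rewrite ?normr1 ?normr0.
  have dxi : `|xi y - xi x| <= B + B by rewrite (le_trans (ler_normB _ _)) // lerD.
  have dw : `|w y - w x| <= D + D by rewrite (le_trans (ler_normB _ _)) // lerD.
  have C_ge : C' <= C by rewrite lerDl.
  apply: le_trans C_ge.
  have prod (b b' e e' : R) : `|b| <= b' -> `|e| <= e' -> `|b * e| <= b' * e'.
    by rewrite normrM; exact: ler_pM.
  have nat_le (n : nat) : `|n%:R : R| <= n%:R by rewrite normr_nat.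
  have sq (b b' : R) : `|b| <= b' -> `|b * b| <= b' * b' by move=> bb; exact: prod.
  have zZ2 : `|2 * z t x| <= 2 * Z.
    by apply: prod => //; exact: nat_le.
  rewrite /g /C' !expr2.
  apply: le_trans (ler_normD _ _) (lerD _ _).
    2: by apply: prod; [exact: nat_le|exact: sq].
  apply: le_trans (ler_normD _ _) (lerD _ _).
    2: by apply: prod; [exact: nat_le|exact: sq].
  apply: le_trans (ler_normD _ _) (lerD _ _); first exact: prod.
  exact: (prod _ _ _ _ (prod _ _ _ _ zZ2 I1) dw).
- move=> h y _.
  have := @reflected_square_semiconcave R u (xi x) (w x + k * t) (xi y)
    (w y + k * (t + h)) (xi0 y).
  rewrite -/(z t x) -/(I t x) /g => /le_trans; apply.
  have C1 : 4 * k ^+ 2 <= C by rewrite lerDr.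
  have h2 : 4 * k ^+ 2 * h ^+ 2 <= C * h ^+ 2 by rewrite ler_wpM2r ?sqr_ge0.
  rewrite -lerBlDl; apply: le_trans h2; rewrite -subr_ge0.
  rewrite [leRHS](_ : _ = 2 * (w y - w x - k * h) ^+ 2); last by ring.
  by rewrite mulr_ge0 ?sqr_ge0.
Qed.

End lyapunov_theory.

(** * The generator of the zero-range process *)

(** Occupation numbers are at most [m], so configurations are functions into a
    finite type. *)
Lemma Omega_enum (n m : nat) :
  exists2 E : seq (Omega n m), uniq E & forall eta, eta \in E.
Proof.
exists (undup (pmap insub [seq [ffun i => (g i : nat)] | g : {ffun 'I_n -> 'I_m.+1}])).
  exact: undup_uniq.
move=> eta; rewrite mem_undup mem_pmap; apply/mapP; exists (val eta); last first.
  by rewrite valK.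
have le_m i : (val eta i < m.+1)%N.
  by rewrite ltnS -[X in (_ <= X)%N](eqP (valP eta)) (bigD1 i) //= leq_addr.
apply/mapP; exists [ffun i => Ordinal (le_m i)]; first by rewrite mem_enum.
by apply/ffunP => i; rewrite !ffunE.
Qed.

Section zero_range.
Context (R : realType) (n m : nat).
Context (n_gt0 : (0 < n)%N).
Local Notation L := (@zrp_generator R n m).
Local Notation S := (Omega n m).

Lemma zrp_linear : linear_op L.
Proof.
move=> a f g x; rewrite /zrp_generator mulrCA -mulrDr; congr (_ * _).
rewrite mulr_sumr -big_split /=; apply: eq_bigr => i _.
rewrite mulr_sumr -big_split /=; apply: eq_bigr => j _.
by case: ifP => _; ring.
Qed.

Lemma zrp_const (a : R) x : L (fun=> a) x = 0.
Proof.
rewrite /zrp_generator big1 ?mulr0 // => i _.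
by rewrite big1 // => j _; rewrite subrr if_same.
Qed.

Let n0 : n%:R != 0 :> R. Proof. by rewrite pnatr_eq0 -lt0n. Qed.

Let n1 : 1 <= n%:R :> R. Proof. by rewrite ler1n. Qed.

Lemma zrp_bounded : bounded_op L (2 * n%:R).
Proof.
move=> f B fB x; rewrite /zrp_generator normrM.
rewrite ger0_norm ?invr_ge0 // ler_pdivrMl ?ltr0n //.
apply: (@le_trans _ _ (\sum_(i < n) \sum_(j < n) (B + B))); last first.
  rewrite !sumr_const card_ord -mulrnA -[leLHS]mulr_natl natrM.
  by apply: eq_le_imp; ring.
apply: le_trans (ler_norm_sum _ _ _) _; apply: ler_sum => i _.
apply: le_trans (ler_norm_sum _ _ _) _; apply: ler_sum => j _.
case: ifP => _; first by rewrite (le_trans (ler_normB _ _)) // lerD.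
by rewrite normr0 addr_ge0 // (le_trans (normr_ge0 (f x))).
Qed.

(** The number of nonempty sites, which is the total rate of departures. *)
Definition busy (eta : S) : R := \sum_(i < n) (0 < occ eta i)%N%:R.

Lemma occ_move_val (eta : S) (i j k : 'I_n) : (0 < occ eta i)%N ->
  (occ (move eta i j) k)%:R =
  (occ eta k)%:R + (k == j)%:R - (k == i)%:R :> R.
Proof.
move=> ei; rewrite occ_move // ffunE natrB ?natrD //.
by case: eqP => [->|//]; rewrite (leq_trans ei) ?leq_addr.
Qed.

Lemma sum_eq_ord (k : 'I_n) : \sum_(j < n) (j == k)%:R = 1 :> R.
Proof. by rewrite (bigD1 k) //= eqxx big1 ?addr0 // => j /negbTE ->. Qed.

(** A site receives a particle from any other nonempty site, and gives one to any
    other site; moves from a site to itself have no effect and must be removed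
    from both counts. *)
Lemma generator_site (phi : nat -> R) (k : 'I_n) (eta : S) :
  L (fun eta => phi (occ eta k)) eta =
  n%:R^-1 * ((busy eta - (0 < occ eta k)%N%:R) *
               (phi (occ eta k).+1 - phi (occ eta k)) +
             (0 < occ eta k)%N%:R * (n%:R - 1) *
               (phi (occ eta k).-1 - phi (occ eta k))).
Proof.
rewrite /zrp_generator; congr (_ * _).
set up := phi _.+1 - _; set down := phi _.-1 - _.
transitivity (\sum_(i < n) (0 < occ eta i)%N%:R *
  ((1 - (i == k)%:R) * up + (i == k)%:R * (n%:R - 1) * down)).
  apply: eq_bigr => i _; case ei: (0 < occ eta i)%N; last first.
    by rewrite mul0r big1.
  transitivity (\sum_(j < n) ((1 - (i == k)%:R) * up * (j == k)%:R +
      (i == k)%:R * down * (1 - (j == k)%:R))); last first.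
    have s1 a : \sum_(j < n) a * (j == k)%:R = a :> R.
      by rewrite -mulr_sumr sum_eq_ord mulr1.
    have s2 a : \sum_(j < n) a * (1 - (j == k)%:R) = a * (n%:R - 1) :> R.
      by rewrite -mulr_sumr sumrB sum_eq_ord sumr_const card_ord.
    by rewrite big_split /= s1 s2; ring.
  apply: eq_bigr => j _; rewrite occ_move // ffunE.
  rewrite [k == j]eq_sym [k == i]eq_sym /up /down.
  case: (i =P k) => [ik|_]; case: (j =P k) => _ /=.
  - by rewrite addnK; ring.
  - by rewrite addn0 subn1; ring.
  - by rewrite addn1 subn0; ring.
  - by rewrite addn0 subn0; ring.
transitivity (\sum_(i < n) ((0 < occ eta i)%N%:R * up +
   (i == k)%:R * ((0 < occ eta k)%N%:R * ((n%:R - 1) * down - up)))).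
  by apply: eq_bigr => i _; case: eqP => [->|_] /=; ring.
rewrite big_split /= -[X in X + _]mulr_suml -[X in _ + X]mulr_suml sum_eq_ord.
by rewrite /busy; ring.
Qed.

Lemma busy_le (eta : S) : busy eta <= n%:R.
Proof.
rewrite -[X in _ <= X%:R]card_ord -sumr_const ler_sum // => i _.
by case: (0 < _)%N.
Qed.

Definition density (k : 'I_n) (eta : S) : R := (occ eta k)%:R / n%:R.
Definition energy (eta : S) : R := \sum_(k < n) density k eta ^+ 2.
Definition empty_fraction (eta : S) : R := 1 - busy eta / n%:R.
Let rhon : R := m%:R / n%:R.
Let theta : R := 1 + rhon - n%:R^-1.

Lemma sum_occ (eta : S) : \sum_(k < n) (occ eta k)%:R = m%:R :> R.
Proof. by rewrite -natr_sum (eqP (valP eta)). Qed.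

Lemma sum_density (eta : S) : \sum_(k < n) density k eta = rhon.
Proof. by rewrite /density -mulr_suml sum_occ. Qed.

Lemma density_ge0 k (eta : S) : 0 <= density k eta.
Proof. by rewrite divr_ge0. Qed.

Lemma empty_fraction_ge0 (eta : S) : 0 <= empty_fraction eta.
Proof. by rewrite subr_ge0 ler_pdivrMr ?ltr0n // mul1r busy_le. Qed.

Lemma generator_density k (eta : S) :
  L (density k) eta =
  n%:R^-1 * ((occ eta k == 0%N)%:R - empty_fraction eta).
Proof.
rewrite [L _ _](@generator_site (fun a => a%:R / n%:R)) /empty_fraction.
by case: (occ eta k) => [|a] /=; rewrite -?[a.+2%:R]natr1 -?[a.+1%:R]natr1;
  field.
Qed.

(** The drift is an affine function of the fraction of empty sites, with
    coefficients that do not depend on the configuration. *)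
Lemma generator_energy (eta : S) :
  L energy eta =
  2 * n%:R^-1 * (1 - n%:R^-1 - empty_fraction eta * theta).
Proof.
have -> : energy = fun eta => \sum_(k < n) 1 * density k eta ^+ 2.
  by apply/funext => eta'; apply: eq_bigr => k _; rewrite mul1r.
rewrite (linear_op_sum zrp_linear).
transitivity (\sum_(k < n) n%:R^-1 ^+ 3 *
  (2 * busy eta * (occ eta k)%:R + busy eta
   - 2 * n%:R * (occ eta k)%:R + (n%:R - 2) * (0 < occ eta k)%N%:R)).
  apply: eq_bigr => k _; rewrite mul1r.
  rewrite [L _ _](@generator_site (fun a => (a%:R / n%:R) ^+ 2)).
  by case: (occ eta k) => [|a] /=; rewrite -?[a.+2%:R]natr1 -?[a.+1%:R]natr1;
    field.
rewrite -mulr_sumr big_split /= sumrB big_split /= -!mulr_sumr sum_occ.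
rewrite -/(busy eta) sumr_const card_ord /empty_fraction /theta /rhon.
by field.
Qed.

Lemma generator_density_square k (eta : S) :
  L (fun zeta => (density k zeta - density k eta) ^+ 2) eta <= 2 * n%:R^-1 ^+ 2.
Proof.
rewrite [L _ _](@generator_site (fun a => (a%:R / n%:R - density k eta) ^+ 2)).
rewrite /density.
rewrite [leLHS](_ : _ =
  n%:R^-1 ^+ 3 * (busy eta + (n%:R - 2) * (0 < occ eta k)%N%:R)); last first.
  by case: (occ eta k) => [|a] /=; rewrite -?[a.+2%:R]natr1 -?[a.+1%:R]natr1;
    field.
rewrite exprS mulrAC ler_wpM2r ?sqr_ge0 // ler_pdivrMl ?ltr0n //.
have := busy_le eta; have := n1; case: (0 < _)%N => /=; lra.
Qed.

Lemma energy_move (eta : S) i j : (0 < occ eta i)%N ->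
  energy (move eta i j) - energy eta =
  (i != j)%:R * 2 * n%:R^-1 ^+ 2 * ((occ eta j)%:R - (occ eta i)%:R + 1).
Proof.
rewrite /energy -sumrB => ei.
move: ei; have [->|ij] := eqVneq i j => ei.
  rewrite /= !mul0r big1 // => k _.
  by rewrite /density occ_move_val // addrK subrr.
transitivity (\sum_(k < n) (n%:R^-1 : R) ^+ 2 * (
    (2 * (occ eta j)%:R + 1) * (k == j)%:R +
    (1 - 2 * (occ eta i)%:R) * (k == i)%:R)); last first.
  rewrite -mulr_sumr big_split /= -[X in X + _]mulr_sumr -[X in _ + X]mulr_sumr.
  by rewrite !sum_eq_ord; ring.
apply: eq_bigr => k _; rewrite /density occ_move_val //.
case: eqP => [->|_]; first by rewrite eq_sym (negbTE ij) /=; field.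
by case: eqP => [->|_] /=; field.
Qed.

(** A move from [i] to [j] changes the energy by about [2 (x_j - x_i) / n].  The
    sum over pairs is needed here: bounding each change by its maximum loses a
    factor [n]. *)
Lemma generator_energy_square (eta : S) :
  L (fun zeta => (energy zeta - energy eta) ^+ 2) eta <=
  8 * rhon ^+ 2 * n%:R^-1 ^+ 2.
Proof.
rewrite /zrp_generator.
have occ2 : \sum_(k < n) (occ eta k)%:R ^+ 2 <= m%:R ^+ 2 :> R.
  rewrite [leRHS]expr2 -{1}(sum_occ eta) mulr_suml ler_sum // => k _.
  rewrite expr2 ler_wpM2l // -(sum_occ eta) (bigD1 k) //= lerDl sumr_ge0 //.
apply: (@le_trans _ _ (n%:R^-1 * \sum_(i < n) \sum_(j < n)
   (4 * n%:R^-1 ^+ 4 * ((occ eta j)%:R ^+ 2 + (occ eta i)%:R ^+ 2)))).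
  rewrite ler_wpM2l ?invr_ge0 // ler_sum // => i _; rewrite ler_sum // => j _.
  case: ifP => ei; last first.
    by rewrite !mulr_ge0 ?addr_ge0 ?exprn_ge0 ?invr_ge0.
  rewrite subrr expr0n /= subr0 energy_move //.
  have i1 : 1 <= (occ eta i)%:R :> R by rewrite ler1n.
  have j0 : 0 <= (occ eta j)%:R :> R by [].
  case: eqP => _ /=.
    by rewrite !mul0r expr0n /= !mulr_ge0 ?addr_ge0 ?exprn_ge0 ?invr_ge0.
  rewrite mul1r exprMn [(2 * _) ^+ 2]exprMn -exprM.
  have -> : 2 ^+ 2 = 4 :> R by ring.
  by apply: ler_wpM2l; [rewrite mulr_ge0 ?exprn_ge0 ?invr_ge0|nra].
under eq_bigr do rewrite -mulr_sumr big_split /= sumr_const card_ord.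
rewrite -mulr_sumr big_split /= sumr_const card_ord sumrMnl -mulrnDl.
rewrite -[X in _ * (_ * X)]mulr_natl.
set s := \sum_(k < n) _ in occ2 *.
apply: (@le_trans _ _ (8 * n%:R^-1 ^+ 4 * m%:R ^+ 2)); last first.
  by rewrite /rhon; apply: eq_le_imp; field.
rewrite [leLHS](_ : _ = 8 * n%:R^-1 ^+ 4 * s); last by field.
by rewrite ler_wpM2l // mulr_ge0 // exprn_ge0 // invr_ge0.
Qed.

(** At a nonempty site the arrival rate is at most the departure rate, so the
    first-order part of the drift is nonpositive and the second-order part is
    linear in [x_k]; summed over the sites it only involves the density of
    particles. *)
Lemma generator_cube (Q : pred 'I_n) (eta : S) :
  L (fun zeta => \sum_(k < n | Q k) density k zeta ^+ 3) eta <=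
  (6 * rhon + 1) * n%:R^-1 ^+ 2.
Proof.
have cube_le k : L (fun zeta => density k zeta ^+ 3) eta <=
    n%:R^-1 ^+ 3 * (6 * (occ eta k)%:R + 1).
  rewrite [L _ _](@generator_site (fun a => (a%:R / n%:R) ^+ 3)).
  have := busy_le eta.
  case: (occ eta k) => [|a] /= bn.
    rewrite (_ : _ * _ = n%:R^-1 ^+ 4 * busy eta); last by field.
    rewrite mulr0 add0r mulr1 exprSr -mulrA ler_piMr ?exprn_ge0 ?invr_ge0 //.
    by rewrite ler_pdivrMl ?ltr0n // mulr1.
  have a0 : 0 <= a%:R :> R by [].
  rewrite -?[a.+2%:R]natr1 -?[a.+1%:R]natr1.
  rewrite (_ : _ * _ = n%:R^-1 ^+ 4 *
     ((busy eta - 1) * (3 * a%:R ^+ 2 + 9 * a%:R + 7) -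
      (n%:R - 1) * (3 * a%:R ^+ 2 + 3 * a%:R + 1))); last by field.
  apply: (@le_trans _ _ (n%:R^-1 ^+ 4 * (n%:R * (6 * (a%:R + 1) + 1)))).
    apply: ler_wpM2l; first by rewrite exprn_ge0 ?invr_ge0.
    have := n1; nra.
  by apply: eq_le_imp; field.
rewrite [L _ _](_ : _ = \sum_(k < n | Q k) 1 * L (fun zeta => density k zeta ^+ 3) eta); last first.
  rewrite -(big_filter _ Q) -(linear_op_sum zrp_linear).
  congr (L _ _); apply/funext => zeta; rewrite big_filter.
  by apply: eq_bigr => k _; rewrite mul1r.
apply: (@le_trans _ _ (\sum_(k < n) n%:R^-1 ^+ 3 * (6 * (occ eta k)%:R + 1))).
  rewrite [leRHS](bigID Q) /= -[leLHS]addr0; apply: lerD.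
    by apply: ler_sum => k _; rewrite mul1r.
  by apply: sumr_ge0 => k _; rewrite mulr_ge0 ?exprn_ge0 ?invr_ge0 ?addr_ge0 ?mulr_ge0.
rewrite -mulr_sumr big_split /= -mulr_sumr sum_occ sumr_const card_ord /rhon.
by apply: eq_le_imp; field.
Qed.

End zero_range.

(** * Lyapunov functions of the zero-range process *)

Section zero_range_lyapunov.
Context (R : realType) (n m : nat) (E : seq (Omega n m)) (T : R).
Context (n_gt0 : (0 < n)%N).
Context (inE : forall eta, eta \in E).
Local Notation L := (@zrp_generator R n m).
Local Notation S := (Omega n m).
Let rhon : R := m%:R / n%:R.
Let theta : R := 1 + rhon - n%:R^-1.
Context (theta_gt0 : 0 < theta).

Let n0 : n%:R != 0 :> R. Proof. by rewrite pnatr_eq0 -lt0n. Qed.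
Let n1 : 1 <= n%:R :> R. Proof. by rewrite ler1n. Qed.
Let theta0 : theta != 0. Proof. by rewrite gt_eqF. Qed.
Let rhon_ge0 : 0 <= rhon. Proof. by rewrite divr_ge0. Qed.
Let rhon_le : rhon <= theta.
Proof.
have : (n%:R^-1 : R) <= 1 by rewrite invf_le1 ?ltr0n.
by rewrite /theta; lra.
Qed.

(** An estimator of the time integral of the fraction of empty sites, in units of
    [n], that is a function of the time and of the current configuration.  The
    terms [n%:R^-1] make its drift exact. *)
Definition clock (eta0 : S) (t : R) (eta : S) : R :=
  ((energy R eta0 - energy R eta) / 2
   + (1 - n%:R^-1) / n%:R * t) / (1 + m%:R / n%:R - n%:R^-1).

Let w0 (eta0 : S) (eta : S) : R := (energy R eta0 - energy R eta) / 2 / theta.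
Let k : R := (1 - n%:R^-1) / n%:R / theta.

(** The energy is affine in the empty fraction, so a suitable multiple of it plus
    a multiple of the time has exactly the empty fraction as its drift. *)
Lemma generator_clock (eta0 eta : S) :
  L (w0 eta0) eta + k = empty_fraction R eta / n%:R.
Proof.
have -> : w0 eta0 = fun eta => - (2 * theta)^-1 * energy R eta +
    (fun=> energy R eta0 / (2 * theta)) eta.
  by apply/funext => zeta; rewrite /w0; field.
rewrite (zrp_linear _ _ (fun=> _)) zrp_const generator_energy // /k.
by rewrite -/rhon -/theta; field; rewrite theta0 n0.
Qed.

(** The constant does not depend on the density because the denominator of the
    clock dominates it. *)
Lemma generator_clock_square (eta0 eta : S) :
  L (fun zeta => (w0 eta0 zeta - w0 eta0 eta) ^+ 2) eta <= 2 * n%:R^-1 ^+ 2.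
Proof.
have -> : (fun zeta => (w0 eta0 zeta - w0 eta0 eta) ^+ 2) = fun zeta =>
    (2 * theta) ^- 2 * (energy R zeta - energy R eta) ^+ 2.
  by apply/funext => zeta; rewrite /w0; field.
rewrite (linear_opZ (@zrp_linear R n m)).
apply: le_trans (ler_wpM2l _ (generator_energy_square R n_gt0 eta)) _.
  by rewrite invr_ge0 sqr_ge0.
rewrite -/rhon [leLHS](_ : _ = (rhon / theta) ^+ 2 * (2 * n%:R^-1 ^+ 2)); last first.
  by field; rewrite theta0 n0.
rewrite ler_piMl // ?mulr_ge0 ?exprn_ge0 ?invr_ge0 //.
have q0 : 0 <= rhon / theta by rewrite divr_ge0 // ltW.
by rewrite expr_le1 // ler_pdivrMr // mul1r.
Qed.

(** If [a < u], the drifts of the site and of the clock cancel except for the push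
    away from [0], and an empty site lies below its target [u - a].  If [a >= u],
    the target is [0] and the drift [- b] of a nonempty site helps. *)
Lemma lyapunov_site (eta0 : S) (u : R) (i : 'I_n) :
  lyapunov L T (fun t eta =>
      (density R i eta - Num.max (u - clock eta0 t eta) 0) ^+ 2)
    (12 * n%:R^-1 ^+ 2).
Proof.
have -> : 12 * n%:R^-1 ^+ 2 = 2 * (2 * n%:R^-1 ^+ 2) + 4 * (2 * n%:R^-1 ^+ 2) :> R.
  by ring.
have -> : (fun t eta => (density R i eta - Num.max (u - clock eta0 t eta) 0) ^+ 2)
  = (fun t eta => (density R i eta - Num.max (u - (w0 eta0 eta + k * t)) 0) ^+ 2).
  apply/funext => t; apply/funext => eta; congr ((_ - Num.max (_ - _) _) ^+ 2).
  by rewrite /clock -/rhon -/theta /w0 /k; field; rewrite theta0 n0.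
apply: (lyapunov_reflected T inE (@zrp_linear R n m)).
- exact: zrp_const.
- exact: density_ge0.
- move=> eta a; rewrite generator_clock generator_density //.
  have b0 := empty_fraction_ge0 R n_gt0 eta.
  (* Both drifts carry the factor [1 / n] of the generator. *)
  have factor (z e b I : R) : z * (n%:R^-1 * (e - b) + I * (b / n%:R)) =
    n%:R^-1 * (z * (e - b + I * b)) by ring.
  rewrite factor pmulr_rle0 ?invr_gt0 ?ltr0n //.
  have d0 := density_ge0 R i eta.
  have [e0|_] := eqVneq (occ eta i) 0%N.
    have -> : density R i eta = 0 by rewrite /density e0 mul0r.
    have [au|ua] := ltP a u => /=.
      rewrite max_l; last by lra.
      nra.
    rewrite max_r; last by lra.
    nra.
  have [au|ua] := ltP a u => /=; first by lra.
  rewrite max_r; last by lra.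
  nra.
- by move=> eta; exact: generator_density_square.
- exact: generator_clock_square.
Qed.

(** The case of a site that stays empty, with target [(- clock)_+]: the clock has
    nonnegative drift, so it does not become negative. *)
Lemma lyapunov_clock (eta0 : S) :
  lyapunov L T (fun t eta => (0 - Num.max (0 - clock eta0 t eta) 0) ^+ 2)
    (12 * n%:R^-1 ^+ 2).
Proof.
have -> : 12 * n%:R^-1 ^+ 2 = 2 * (2 * n%:R^-1 ^+ 2) + 4 * (2 * n%:R^-1 ^+ 2) :> R.
  by ring.
have -> : (fun t eta => (0 - Num.max (0 - clock eta0 t eta) 0) ^+ 2)
  = (fun t eta => ((fun=> 0) eta - Num.max (0 - (w0 eta0 eta + k * t)) 0) ^+ 2).
  apply/funext => t; apply/funext => eta; congr ((_ - Num.max (_ - _) _) ^+ 2).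
  by rewrite /clock -/rhon -/theta /w0 /k; field; rewrite theta0 n0.
apply: (lyapunov_reflected T inE (@zrp_linear R n m)).
- exact: zrp_const.
- by [].
- move=> eta a; rewrite generator_clock zrp_const add0r.
  have b0 := empty_fraction_ge0 R n_gt0 eta.
  have bn0 : 0 <= empty_fraction R eta / n%:R by rewrite divr_ge0.
  have [au|ua] := ltP a 0 => /=; last by lra.
  rewrite max_l; last by lra.
  nra.
- move=> eta; rewrite (_ : L _ eta = 0) ?mulr_ge0 ?exprn_ge0 ?invr_ge0 //.
  exact: (zrp_const ((0 - 0) ^+ 2)).
- exact: generator_clock_square.
Qed.

Definition discrepancy (u : nat -> R) (K : nat) (eta0 : S) (t : R) (eta : S) : R :=
  \sum_(i < n | (i < K)%N)
      (density R i eta - Num.max (u i - clock eta0 t eta) 0) ^+ 2 +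
  (0 - Num.max (0 - clock eta0 t eta) 0) ^+ 2.

(** Third powers of the small sites have a drift of order [1 / n], whereas their
    squares do not; by Cauchy-Schwarz against the first powers they still control
    the squares. *)
Definition tail_cube (K : nat) (eta : S) : R :=
  \sum_(i < n | ~~ (i < K)%N) density R i eta ^+ 3.

Lemma lyapunov_zero_range (u : nat -> R) (K : nat) (M : R) (eta0 : S) : 0 <= M ->
  lyapunov L T (fun t eta => M * discrepancy u K eta0 t eta + tail_cube K eta)
    (M * (\sum_(i < n | (i < K)%N) 12 * n%:R^-1 ^+ 2 + 12 * n%:R^-1 ^+ 2)
     + (6 * rhon + 1) * n%:R^-1 ^+ 2).
Proof.
move=> M0; apply: (lyapunovD (@zrp_linear R n m)).
  apply: (lyapunovZ (@zrp_linear R n m)) => //.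
  apply: (lyapunovD (@zrp_linear R n m)); last exact: lyapunov_clock.
  apply: (lyapunov_sum (@zrp_linear R n m) _ (F := fun i t eta =>
    (density R i eta - Num.max (u i - clock eta0 t eta) 0) ^+ 2)) => i _.
  exact: lyapunov_site.
apply: (lyapunov_static T inE (@zrp_linear R n m)); first exact: zrp_const.
by move=> eta; exact: generator_cube.
Qed.

End zero_range_lyapunov.

(** * The limiting dynamics *)

Lemma pos_part_lipschitz (R : realType) (a b : R) :
  `|Num.max a 0 - Num.max b 0| <= `|a - b|.
Proof.
have := ler_norm (a - b); have := ler_norm (b - a); rewrite distrC ler_norml.
by have [?|?] := leP a 0; have [?|?] := leP b 0 => ? ?;
  apply/andP; split; lra.
Qed.

Section limit.
Context (R : realType) (rho : R) (u : nat -> R).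
Context (u_ge0 : forall k, 0 <= u k)
  (u_sum : forall k, \sum_(j < k) u j <= rho).

(** The mass of the [j]-th large site once an amount [w] has left it. *)
Definition excess (w : R) (j : nat) : R := Num.max (u j - w) 0.
Definition bulk (w : R) : R := limn (series (excess w)).
Definition bulk_energy (w : R) : R := limn (series (fun j => excess w j ^+ 2 / 2)).
(** Up to a constant, the time after which each large site has lost an amount
    [w], or is empty. *)
Definition potential (w : R) : R := bulk_energy w + (1 + rho) * w.

Lemma excess_ge0 w j : 0 <= excess w j.
Proof. by rewrite /excess le_max lexx orbT. Qed.

Lemma excess_le w j : 0 <= w -> excess w j <= u j.
Proof. by move=> w0; rewrite /excess ge_max u_ge0 andbT gerBl. Qed.

Lemma series_bounded_cvg (f : nat -> R) : (forall j, 0 <= f j <= u j) ->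
  cvgn (series f).
Proof.
move=> fu; apply: nondecreasing_is_cvgn.
  by apply: nondecreasing_series => j _ _; have /andP[] := fu j.
exists rho => _ [k _ <-]; apply: le_trans (u_sum k).
by rewrite /series /= big_mkord; apply: ler_sum => j _; have /andP[] := fu j.
Qed.

Lemma cvg_excess w : 0 <= w -> cvgn (series (excess w)).
Proof.
by move=> w0; apply: series_bounded_cvg => j; rewrite excess_ge0 excess_le.
Qed.

Lemma rho_ge0 : 0 <= rho.
Proof. by have := u_sum 0; rewrite big_ord0. Qed.

Lemma u_le_rho j : u j <= rho.
Proof.
apply: le_trans (u_sum j.+1); rewrite big_ord_recr /= lerDr.
exact: sumr_ge0.
Qed.

Lemma cvg_excess_square w : 0 <= w -> cvgn (series (fun j => excess w j ^+ 2 / 2)).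
Proof.
move=> w0; apply: (@series_le_cvg _ _ (rho *: excess w)).
- by move=> j; rewrite divr_ge0 // sqr_ge0.
- by move=> j; rewrite mulr_ge0 ?rho_ge0 ?excess_ge0.
- move=> j; rewrite -[leRHS]/(rho * excess w j) expr2.
  have := le_trans (excess_le j w0) (u_le_rho j); have := excess_ge0 w j; nra.
- exact/is_cvg_seriesZ/cvg_excess.
Qed.

Lemma bulk_le w : 0 <= w -> 0 <= bulk w <= rho.
Proof.
move=> w0; apply/andP; split.
  apply: limr_ge; first exact: cvg_excess.
  by apply: nearW => k; apply: sumr_ge0 => j _; exact: excess_ge0.
apply: limr_le; first exact: cvg_excess.
apply: nearW => k; apply: le_trans (u_sum k).
by rewrite /series /= big_mkord; apply: ler_sum => j _; exact: excess_le.
Qed.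

(** The square is convex and [w |-> excess w j] decreases with slope [-1] or
    [0]. *)
Lemma excess_square_le w w' j : w <= w' ->
  (w' - w) * excess w' j <= excess w j ^+ 2 / 2 - excess w' j ^+ 2 / 2 <=
  (w' - w) * excess w j.
Proof.
move=> ww'; rewrite /excess.
by have [?|?] := leP (u j - w) 0; have [?|?] := leP (u j - w') 0;
  apply/andP; split; nra.
Qed.

(** The derivative of the potential is [1 + rho - bulk]: comparing the series term
    by term gives both bounds. *)
Lemma potential_slope w w' : 0 <= w -> w <= w' ->
  (w' - w) * (1 + rho - bulk w) <= potential w' - potential w <=
  (w' - w) * (1 + rho - bulk w').
Proof.
move=> w0 ww'; have w'0 := le_trans w0 ww'.
have cs := cvg_excess_square w0; have cs' := cvg_excess_square w'0.
have ce := cvg_excess w0; have ce' := cvg_excess w'0.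
have le1 : (w' - w) * bulk w' <= bulk_energy w - bulk_energy w'.
  rewrite -lim_seriesB // -[leLHS]/((w' - w) *: bulk w') -lim_seriesZ //.
  apply: lim_series_le; [exact: is_cvg_seriesZ|exact: is_cvg_seriesB|].
  by move=> j; have /andP[] := excess_square_le j ww'.
have le2 : bulk_energy w - bulk_energy w' <= (w' - w) * bulk w.
  rewrite -lim_seriesB // -[leRHS]/((w' - w) *: bulk w) -lim_seriesZ //.
  apply: lim_series_le; [exact: is_cvg_seriesB|exact: is_cvg_seriesZ|].
  by move=> j; have /andP[] := excess_square_le j ww'.
by rewrite /potential; apply/andP; split; nra.
Qed.

Lemma potential_slope_ge w w' : 0 <= w -> 0 <= w' ->
  `|w' - w| <= `|potential w' - potential w|.
Proof.
wlog ww' : w w' / w <= w'.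
  move=> H w0 w'0; have [|/ltW] := leP w w'; first by move=> ?; exact: H.
  by move=> ?; rewrite distrC [leRHS]distrC; exact: H.
move=> w0 w'0; have /andP[h _] := potential_slope w0 ww'.
have /andP[_ b] := bulk_le w0.
rewrite ger0_norm ?subr_ge0 //; apply: le_trans (ler_norm _).
apply: le_trans h; nra.
Qed.

Lemma potential_slope_le w w' : 0 <= w -> 0 <= w' ->
  `|potential w' - potential w| <= (1 + rho) * `|w' - w|.
Proof.
wlog ww' : w w' / w <= w'.
  move=> H w0 w'0; have [|/ltW] := leP w w'; first by move=> ?; exact: H.
  by move=> ?; rewrite distrC [`|w' - w|]distrC; exact: H.
move=> w0 w'0; have /andP[h h'] := potential_slope w0 ww'.
have /andP[_ b] := bulk_le w0; have /andP[b' _] := bulk_le w'0.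
rewrite [`|w' - w|]ger0_norm ?subr_ge0 // ger0_norm; last by apply: le_trans h; nra.
apply: le_trans h' _; nra.
Qed.

(** Each term is 1-Lipschitz in [w], and the terms of index at least [K] are
    dominated by those of the convergent series [u]. *)
Lemma bulk_modulus (K : nat) w w' : 0 <= w -> 0 <= w' ->
  `|bulk w' - bulk w| <= K%:R * `|w' - w| + (limn (series u) - series u K).
Proof.
wlog ww' : w w' / w <= w'.
  move=> H w0 w'0; have [|/ltW] := leP w w'; first by move=> ?; exact: H.
  by move=> ?; rewrite distrC [`|w' - w|]distrC; exact: H.
move=> w0 w'0; rewrite distrC (ger0_norm (_ : 0 <= w' - w)) ?subr_ge0 //.
have ce := cvg_excess w0; have ce' := cvg_excess w'0.
have cu : cvgn (series u).
  by apply: series_bounded_cvg => j; rewrite u_ge0 lexx.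
have ww j : 0 <= excess w j - excess w' j <= w' - w.
  rewrite /excess.
  by have [?|?] := leP (u j - w) 0; have [?|?] := leP (u j - w') 0;
    apply/andP; split; lra.
rewrite ger0_norm; last first.
  rewrite subr_ge0; apply: lim_series_le => // j.
  by rewrite -subr_ge0; have /andP[] := ww j.
rewrite -lim_seriesB //; apply: limr_le; first exact: is_cvg_seriesB.
near=> n; have Kn : (K <= n)%N by near: n; exists K.
have un : series u n <= limn (series u).
  by apply: nondecreasing_cvgn_le => //; apply: nondecreasing_series.
rewrite /series /= (big_cat_nat (n := K)) //=; apply: lerD.
  rewrite big_mkord mulr_natl -[X in _ *+ X]card_ord -sumr_const.
  by apply: ler_sum => j _; have /andP[] := ww j.
apply: (@le_trans _ _ (\sum_(K <= j < n) u j)).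
  apply: ler_sum => j _; rewrite -[leRHS]subr0.
  by apply: lerB; [exact: excess_le|exact: excess_ge0].
move: un; rewrite /series /= (big_cat_nat (n := K)) //=; lra.
Unshelve. all: by end_near. Qed.

Lemma potential_continuous : continuous (fun w : R => potential (Num.max w 0)).
Proof.
move=> w; apply/cvgrPdist_le => e e0; near=> w'.
have max0 (a : R) : 0 <= Num.max a 0 by rewrite le_max lexx orbT.
apply: le_trans (potential_slope_le (max0 _) (max0 _)) _.
rewrite -ler_pdivlMl; last by have := rho_ge0; lra.
have : `|w - w'| <= (1 + rho)^-1 * e.
  near: w'; apply: cvgr_dist_le; first exact: cvg_id.
  by rewrite mulr_gt0 // invr_gt0; have := rho_ge0; lra.
by apply: le_trans; exact: pos_part_lipschitz.
Unshelve. all: by end_near. Qed.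

(** The potential is continuous with slope at least [1] on the half-line, so it
    can be inverted there. *)
Lemma consumption_exists : exists omega : R -> R,
  forall t, 0 <= omega t /\ potential (omega t) = potential 0 + Num.max t 0.
Proof.
suff H t : exists w, 0 <= w /\ potential w = potential 0 + Num.max t 0.
  by have [f fP] := choice H; exists f.
have max0 (a : R) : 0 <= Num.max a 0 by rewrite le_max lexx orbT.
have [||w] := @IVT R (fun w => potential (Num.max w 0)) 0 (Num.max t 0)
  (potential 0 + Num.max t 0) (max0 t).
- by apply: continuous_subspaceT => w; exact: potential_continuous.
- have /andP[sl _] := potential_slope (lexx 0) (max0 t).
  have /andP[_ b] := bulk_le (lexx 0).
  rewrite maxxx (max_l (max0 t)) ge_min le_max lerDl (max0 t) /=.
  apply/orP; right; have := max0 t; nra.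
- rewrite in_itv /= => /andP[w0 _] <-; exists w.
  by rewrite w0 (max_l w0).
Qed.

Context (omega : R -> R).
Context (omega_ge0 : forall t, 0 <= omega t).
Context (potential_omega : forall t,
  potential (omega t) = potential 0 + Num.max t 0).

Lemma omega_lipschitz t s : `|omega t - omega s| <= `|t - s|.
Proof.
apply: le_trans (potential_slope_ge (omega_ge0 s) (omega_ge0 t)) _.
rewrite !potential_omega.
by rewrite opprD addrACA subrr add0r; exact: pos_part_lipschitz.
Qed.

Lemma omega0 t : t <= 0 -> omega t = 0.
Proof.
move=> t0; apply/eqP; rewrite -normr_le0 -[omega t]subr0.
apply: le_trans (potential_slope_ge (lexx 0) (omega_ge0 t)) _.
by rewrite potential_omega max_r // addr0 subrr normr0.
Qed.

Lemma omega_continuous : continuous omega.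
Proof.
move=> t; apply/cvgrPdist_le => e e0; near=> s.
apply: le_trans (omega_lipschitz _ _) _.
by near: s; apply: cvgr_dist_le => //; exact: cvg_id.
Unshelve. all: by end_near. Qed.

Let rate (t : R) : R := 1 / (1 + rho - bulk (omega t)).

Lemma bulk_omega_continuous : continuous (fun t => bulk (omega t)).
Proof.
move=> t; apply/cvgrPdist_le => e e0.
have cu : cvgn (series u).
  by apply: series_bounded_cvg => j; rewrite u_ge0 lexx.
have e2 : 0 < e / 2 by rewrite divr_gt0.
have /cvgrPdist_le /(_ _ e2) [K _ HK] := cu.
have uK : limn (series u) - series u K <= e / 2.
  by apply: le_trans (ler_norm _) _; apply: HK => /=.
near=> s; apply: le_trans (bulk_modulus K (omega_ge0 s) (omega_ge0 t)) _.
rewrite [leRHS]splitr; apply: lerD => //.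
have : `|t - s| <= (K.+1)%:R^-1 * (e / 2).
  near: s; apply: cvgr_dist_le; first exact: cvg_id.
  by rewrite mulr_gt0 // invr_gt0.
rewrite ler_pdivlMl // => h; apply: le_trans h.
by apply: ler_pM => //; [rewrite ler_nat|exact: omega_lipschitz].
Unshelve. all: by end_near. Qed.

Lemma rate_denominator t : 1 <= 1 + rho - bulk (omega t).
Proof. by have /andP[_] := bulk_le (omega_ge0 t); lra. Qed.

Lemma rate_continuous : continuous rate.
Proof.
have -> : rate = fun t => (1 + rho - bulk (omega t))^-1.
  by apply/funext => t; rewrite /rate div1r.
move=> t; apply: cvgV.
  by have := rate_denominator t; lra.
by apply: cvgB; [exact: cvg_cst|exact: bulk_omega_continuous].
Qed.

Lemma omega_homo t s : 0 <= t -> t <= s -> omega t <= omega s.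
Proof.
move=> t0 ts; rewrite leNgt; apply/negP => st.
have /andP[h _] := potential_slope (omega_ge0 s) (ltW st).
move: h; rewrite !potential_omega (max_l t0) (max_l (le_trans t0 ts)).
have := rate_denominator s; nra.
Qed.

(** The potential grows at unit speed along [omega], and [potential_slope] compares
    it with the increments of [omega]. *)
Lemma omega_slope t s : 0 <= t -> t <= s ->
  (s - t) * rate s <= omega s - omega t <= (s - t) * rate t.
Proof.
move=> t0 ts; have := potential_slope (omega_ge0 t) (omega_homo t0 ts).
rewrite !potential_omega (max_l t0) (max_l (le_trans t0 ts)).
rewrite opprD addrACA subrr add0r => /andP[h h'].
have dt := rate_denominator t; have ds := rate_denominator s.
rewrite /rate !div1r ler_pdivrMr ?ler_pdivlMr ?h ?h' //; lra.
Qed.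

Lemma omega_increment t s : 0 <= t -> 0 <= s ->
  `|omega s - omega t - (s - t) * rate t| <= `|s - t| * `|rate s - rate t|.
Proof.
move=> t0 s0; rewrite -normrM.
have := ler_norm ((s - t) * (rate s - rate t)).
have := ler_norm (- ((s - t) * (rate s - rate t))); rewrite normrN ler_norml.
have [ts|/ltW st] := leP t s => b b'.
  have /andP[h h'] := omega_slope t0 ts.
  by apply/andP; split; [lra|apply: le_trans (normr_ge0 _); lra].
have /andP[h h'] := omega_slope s0 st.
by apply/andP; split; [lra|apply: le_trans (normr_ge0 _); lra].
Qed.

(** Difference quotients lie between values of the continuous rate. *)
Lemma omega_derive (t : R) : 0 < t -> is_derive t (1 : R) omega (rate t).
Proof.
move=> t0.
have rate_shift : rate (h + t) @[h --> (0 : R)^'] --> rate t.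
  apply: (@cvg_within_filter _ _ _ (nbhs (0 : R))).
  have shift0 : h + t @[h --> (0 : R)] --> (0 + t : R).
    by apply: cvgD; [exact: cvg_id|exact: cvg_cst].
  rewrite add0r in shift0.
  exact: cvg_comp shift0 (@rate_continuous t).
have cvd : h^-1 *: ((omega \o shift t) (h *: 1) - omega t) @[h --> (0 : R)^'] --> rate t.
  apply/cvgrPdist_le => e e0.
  have near_rate : \forall h \near (0 : R)^', `|rate t - rate (h + t)| <= e.
    by move/cvgrPdist_le : rate_shift; exact.
  near=> h.
  have h0 : h != 0 by near: h; exact: nbhs_dnbhs_neq.
  have th : 0 <= h + t.
    have : `|h| <= t.
      near: h; apply: dnbhs0_le; exact: t0.
    by rewrite ler_norml => /andP[]; lra.
  rewrite /= [h *: 1]mulr1 distrC.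
  have -> : h^-1 *: (omega (h + t) - omega t) - rate t =
     h^-1 * (omega (h + t) - omega t - (h + t - t) * rate t).
    by rewrite addrK mulrBr [_ * (h * _)]mulrA mulVf // mul1r.
  rewrite normrM normfV ler_pdivrMl ?normr_gt0 //.
  apply: le_trans (omega_increment (ltW t0) th) _.
  rewrite addrK ler_wpM2l // [leLHS]distrC.
  by near: h; exact: near_rate.
by apply: DeriveDef; [exact: cvgP cvd|exact: cvg_lim cvd].
Unshelve. all: by end_near. Qed.

Lemma omega_integral t : 0 <= t ->
  \int[lebesgue_measure]_(s in `[0, t]) rate s = omega t.
Proof.
rewrite le_eqVlt => /predU1P[<-|t0].
  by rewrite set_itv1 Rintegral_set1 omega0.
rewrite /Rintegral (@continuous_FTC2 _ rate omega 0 t) //.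
- by rewrite (omega0 (lexx 0)) sube0.
- exact: continuous_subspaceT rate_continuous.
- split => [s||].
  + by rewrite in_itv /= => /andP[s0 _]; have [] := omega_derive s0.
  + by apply: cvg_at_right_filter; exact: omega_continuous.
  + by apply: cvg_at_left_filter; exact: omega_continuous.
- move=> s; rewrite in_itv /= => /andP[s0 _].
  by rewrite derive1E; have [] := omega_derive s0.
Qed.

End limit.

(** * Stability of the limiting dynamics *)

Section truncation.
Context (R : realType) (rho : R) (u : nat -> R).
Context (u_ge0 : forall k, 0 <= u k)
  (u_sum : forall k, \sum_(j < k) u j <= rho)
  (u_noninc : forall k l : nat, (k <= l)%N -> u l <= u k).

(** From [K] on, a square is at most [u K] times the corresponding mass. *)
Lemma bulk_energy_truncate (K : nat) w : 0 <= w ->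
  \sum_(j < K) excess u w j ^+ 2 / 2 <= bulk_energy u w <=
  \sum_(j < K) excess u w j ^+ 2 / 2 + u K * rho / 2.
Proof.
move=> w0; have cs := cvg_excess_square u_ge0 u_sum w0.
have sq0 j : 0 <= excess u w j ^+ 2 / 2 by rewrite divr_ge0 // sqr_ge0.
apply/andP; split.
  rewrite -(big_mkord xpredT (fun j => excess u w j ^+ 2 / 2)).
  apply: (nondecreasing_cvgn_le _ cs K).
  by apply: nondecreasing_series => j _ _.
apply: limr_le => //; near=> n; have Kn : (K <= n)%N by near: n; exists K.
rewrite /series /= (big_cat_nat (n := K)) //= big_mkord lerD2l.
apply: (@le_trans _ _ (\sum_(K <= j < n) u K / 2 * u j)).
  rewrite big_nat [leRHS]big_nat; apply: ler_sum => j /andP[Kj _].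
  have := excess_le u_ge0 j w0; have := excess_ge0 u w j; have := u_noninc Kj.
  have := u_ge0 j; nra.
rewrite -mulr_sumr [leRHS]mulrAC ler_wpM2l ?divr_ge0 //.
apply: le_trans (u_sum n); rewrite -(big_mkord xpredT u) [leRHS](big_cat_nat (n := K)) //=.
by rewrite lerDr sumr_ge0.
Unshelve. all: by end_near. Qed.

End truncation.

Lemma sum_head (R : realType) (n K : nat) (f : nat -> R) : (K <= n)%N ->
  \sum_(i < n | (i < K)%N) f i = \sum_(j < K) f j.
Proof. by move=> Kn; rewrite (big_ord_widen _ _ Kn). Qed.

Section stability.
Context (R : realType) (rho T : R) (u : nat -> R).
Context (u_ge0 : forall k, 0 <= u k)
  (u_sum : forall k, \sum_(j < k) u j <= rho)
  (u_noninc : forall k l : nat, (k <= l)%N -> u l <= u k).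
Context (omega : R -> R).
Context (omega_ge0 : forall t, 0 <= omega t).
Context (potential_omega : forall t,
  potential rho u (omega t) = potential rho u 0 + Num.max t 0).

(** Collects the constants of the proof of [stability]; it does not depend on the
    truncation level. *)
Definition stability_constant : R :=
  5 * rho + 8 + T + 2 * (2 * (bulk_energy u 0 + 1 + T) + 1).

(** Every term of the relation defining the clock is compared with its
    counterpart in the equation for [omega], so that the potentials at the clock
    and at [omega s] differ by [O(tau)], and so do their arguments.  Squares of
    the large sites cost [K] times the individual error, whence the tolerance
    [tau / K.+1]; squares of the small sites are bounded through the cubes.  The
    potential is only defined for nonnegative arguments: the clock is replaced by
    its positive part, at a price controlled by the last term of
    [discrepancy]. *)
Lemma stability (n m K : nat) (eta0 eta : Omega n m) (tau s : R) (i : 'I_n) :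
  (0 < n)%N -> (i < K)%N -> (K <= n)%N -> 0 <= s <= T -> 0 < tau <= 1 / 2 ->
  discrepancy u K eta0 (n%:R * s) eta <= (tau / K.+1%:R) ^+ 2 ->
  tail_cube R K eta <= tau ^+ 2 ->
  u K <= tau -> `|rho - m%:R / n%:R| <= tau -> n%:R^-1 <= tau ->
  `|energy R eta0 / 2 - bulk_energy u 0| <= tau ->
  `|density R i eta - excess u (omega s) i| <= tau * stability_constant.
Proof.
move=> n0 iK Kn /andP[s0 sT] /andP[tau0 tau1] disc tail uK rhon_close ninv Q0.
have rho0 := rho_ge0 u_sum.
set rhon := m%:R / n%:R in rhon_close *.
have rhon0 : 0 <= rhon by rewrite divr_ge0.
pose W := clock eta0 (n%:R * s) eta.
pose Wp := Num.max W 0.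
pose beta := tau / K.+1%:R.
pose x k := density R k eta.
have K1 : 1 <= K.+1%:R :> R by rewrite ler1n.
have beta0 : 0 < beta by rewrite divr_gt0.
have beta_le : beta <= tau by rewrite ler_pdivrMr // ler_peMr // ltW.
have Kbeta : K%:R * beta <= tau.
  by rewrite mulrCA ler_piMr ?(ltW tau0) // ler_pdivrMr // mul1r ler_nat.
have square_le (a : R) : a ^+ 2 <= beta ^+ 2 -> `|a| <= beta.
  by move=> ab; rewrite -(ger0_norm (ltW beta0)) -ler_sqr ?nnegrE // !real_normK ?num_real.
have head_ge0 : 0 <= \sum_(k < n | (k < K)%N)
    (density R k eta - Num.max (u k - W) 0) ^+ 2.
  by apply: sumr_ge0 => k _; exact: sqr_ge0.
have W_ge : - beta <= W.
  have : `|0 - Num.max (0 - W) 0| <= beta.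
    by apply: square_le; apply: le_trans disc; rewrite lerDr.
  by rewrite !sub0r normrN; have [|] := leP (- W) 0; rewrite ler_norml; lra.
have Wp_ge0 : 0 <= Wp by rewrite le_max lexx orbT.
have Wp_W : 0 <= Wp - W <= beta.
  by rewrite /Wp; have [|] := leP W 0; lra.
have z_le (k : 'I_n) : (k < K)%N -> `|x k - excess u W k| <= beta.
  move=> kK; apply: square_le; apply: le_trans disc.
  rewrite /discrepancy -/W (bigD1 k) //= -addrA lerDl.
  by rewrite addr_ge0 ?sqr_ge0 // sumr_ge0 // => j _; exact: sqr_ge0.
have zp_le (k : 'I_n) : (k < K)%N -> `|x k - excess u Wp k| <= 2 * beta.
  move=> kK; rewrite -(subrKA (excess u W k)).
  apply: le_trans (ler_normD _ _) _; rewrite mulr2n mulrDl mul1r.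
  apply: lerD; first exact: z_le.
  apply: le_trans (pos_part_lipschitz _ _) _.
  rewrite (_ : _ - _ = Wp - W); last by ring.
  by rewrite ger0_norm; case/andP: Wp_W.
have x_ge0 k : 0 <= x k by exact: density_ge0.
have x_sum : \sum_(k < n) x k = rhon by exact: sum_density.
have rhon_le : rhon <= rho + tau.
  by move: rhon_close; rewrite ler_norml; lra.
have x_le k : x k <= rho + 1.
  apply: (@le_trans _ _ rhon); last lra.
  by rewrite -x_sum (bigD1 k) //= lerDl sumr_ge0.
have energy_head : `|\sum_(k < n | (k < K)%N) x k ^+ 2 -
    \sum_(j < K) excess u Wp j ^+ 2| <= tau * (2 * (2 * rho + 1)).
  rewrite -(sum_head (fun j => excess u Wp j ^+ 2) Kn) -sumrB.
  apply: le_trans (ler_norm_sum _ _ _) _.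
  apply: (@le_trans _ _ (\sum_(k < n | (k < K)%N) 2 * beta * (2 * rho + 1))).
    apply: ler_sum => k kK; rewrite subr_sqr normrM; apply: ler_pM => //.
      exact: zp_le.
    have e0 := excess_ge0 u Wp k.
    have e1 := le_trans (excess_le u_ge0 k Wp_ge0) (u_le_rho u_ge0 u_sum k).
    by rewrite ger0_norm; [have := x_le k; lra|rewrite addr_ge0].
  rewrite (sum_head (fun=> 2 * beta * (2 * rho + 1)) Kn) sumr_const card_ord.
  rewrite -[leLHS]mulr_natl.
  have : K%:R * beta * (2 * (2 * rho + 1)) <= tau * (2 * (2 * rho + 1)).
    by apply: ler_wpM2r => //; lra.
  apply: le_trans; apply: eq_le_imp; ring.
have energy_tail : 0 <= \sum_(k < n | ~~ (k < K)%N) x k ^+ 2 <= tau * (rho + 2) / 2.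
  apply/andP; split; first by apply: sumr_ge0 => k _; exact: sqr_ge0.
  (* The arithmetic-geometric mean inequality, with the weight that balances the
     bounds on first and third powers. *)
  apply: (@le_trans _ _ (\sum_(k < n | ~~ (k < K)%N)
     (tau / 2 * x k + (2 * tau)^-1 * x k ^+ 3))).
    apply: ler_sum => k _.
    rewrite -subr_ge0 (_ : _ - _ = x k * (2 * tau)^-1 * (x k - tau) ^+ 2); last first.
      by field; rewrite gt_eqF.
    by rewrite mulr_ge0 ?sqr_ge0 // mulr_ge0 // invr_ge0 mulr_ge0 // ltW.
  rewrite big_split /= -!mulr_sumr.
  have h1 : \sum_(k < n | ~~ (k < K)%N) x k <= rhon.
    rewrite -x_sum [leRHS](bigID (fun k : 'I_n => (k < K)%N)) /= lerDr.
    exact: sumr_ge0.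
  have h2 : (2 * tau)^-1 * tail_cube R K eta <= tau / 2.
    rewrite ler_pdivrMl; last by rewrite mulr_gt0.
    by apply: le_trans tail _; apply: eq_le_imp; field.
  rewrite /tail_cube in h2; nra.
have energy_split : energy R eta = \sum_(k < n | (k < K)%N) x k ^+ 2 +
    \sum_(k < n | ~~ (k < K)%N) x k ^+ 2.
  by rewrite /energy (bigID (fun k : 'I_n => (k < K)%N)).
have /andP[be1 be2] := bulk_energy_truncate u_ge0 u_sum u_noninc K Wp_ge0.
have uKr : u K * rho <= tau * rho by rewrite ler_wpM2r.
have energy_close : `|bulk_energy u Wp - energy R eta / 2| <= tau * (4 * rho + 2).
  rewrite -mulr_suml in be1 be2.
  move: energy_head energy_tail; rewrite !ler_norml energy_split.
  move=> /andP[? ?] /andP[? ?]; apply/andP; split; nra.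
have theta_ge : 1 / 2 <= 1 + rhon - n%:R^-1 by lra.
have clockE : (1 + rhon - n%:R^-1) * W =
    (energy R eta0 - energy R eta) / 2 + (1 - n%:R^-1) * s.
  rewrite /W /clock -/rhon mulrC divfK; last by rewrite gt_eqF //; lra.
  by congr (_ + _); field; rewrite pnatr_eq0 -lt0n.
have energy_ge0 : 0 <= energy R eta by apply: sumr_ge0 => k _; exact: sqr_ge0.
have ninv0 : 0 <= n%:R^-1 :> R by rewrite invr_ge0.
have be0 : 0 <= bulk_energy u 0.
  have /andP[+ _] := bulk_energy_truncate u_ge0 u_sum u_noninc 0 (lexx 0).
  by rewrite big_ord0.
have Q0_le : energy R eta0 / 2 <= bulk_energy u 0 + 1.
  by move: Q0; rewrite ler_norml; lra.
have ns : 0 <= n%:R^-1 * s <= tau * T.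
  by rewrite mulr_ge0 //=; apply: ler_pM.
have W_le : W <= 2 * (bulk_energy u 0 + 1 + T).
  have [W0|W0] := leP W 0; first by apply: le_trans W0 _; nra.
  have : 1 / 2 * W <= (1 + rhon - n%:R^-1) * W by rewrite ler_wpM2r // ltW.
  by rewrite clockE; move/andP: ns; lra.
have potential_close : `|potential rho u Wp - potential rho u (omega s)| <=
    tau * (stability_constant - 2).
  pose B := 2 * (bulk_energy u 0 + 1 + T) + 1.
  have WB : `|(rho - rhon + n%:R^-1) * W| <= tau * (2 * B).
    rewrite normrM mulrA [tau * 2]mulrC; apply: ler_pM => //.
      by apply: le_trans (ler_normD _ _) _; rewrite (ger0_norm ninv0); lra.
    by rewrite ler_norml /B; apply/andP; split; lra.
  rewrite potential_omega (max_l s0) /potential mulr0 addr0.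
  have -> : bulk_energy u Wp + (1 + rho) * Wp - (bulk_energy u 0 + s) =
    (bulk_energy u Wp - energy R eta / 2) + (1 + rho) * (Wp - W) +
    (rho - rhon + n%:R^-1) * W + (energy R eta0 / 2 - bulk_energy u 0) -
    n%:R^-1 * s.
    by move: clockE; lra.
  have rW : 0 <= (1 + rho) * (Wp - W) <= tau * (1 + rho).
    case/andP: Wp_W => ? ?; apply/andP; split; first by apply: mulr_ge0 => //; lra.
    by rewrite mulrC; apply: ler_wpM2r; lra.
  move: WB energy_close Q0 ns rW; rewrite /stability_constant -/B !ler_norml.
  move=> /andP[? ?] /andP[? ?] /andP[? ?] /andP[? ?] /andP[? ?].
  by apply/andP; split; lra.
have Wp_omega := potential_slope_ge u_ge0 u_sum (omega_ge0 s) Wp_ge0.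
rewrite -/(x i) -(subrKA (excess u Wp i)).
apply: le_trans (ler_normD _ _) _.
have := zp_le i iK.
have : `|excess u Wp i - excess u (omega s) i| <= `|Wp - omega s|.
  apply: le_trans (pos_part_lipschitz _ _) _.
  by rewrite opprB addrC subrKA distrC.
move: potential_close; lra.
Qed.

End stability.

(** * Initial configurations *)

Lemma site_ord (n m : nat) (eta : Omega n m) (i : 'I_n) :
  site eta i = occ eta i.
Proof. by rewrite /site valK. Qed.

Section initial.
Context (R : realType) (rho : R) (m : nat -> nat)
    (eta0 : forall n : nat, Omega n.+1 (m n.+1)) (u : nat -> R).
Context (m_cvg : (fun n : nat => (m n)%:R / n%:R : R) @ \oo --> rho)
    (eta0_sorted : forall (n : nat) (i j : 'I_n.+1),
      (i <= j)%N -> (occ (eta0 n) j <= occ (eta0 n) i)%N)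
    (eta0_cvg : forall k : nat,
      (fun n : nat => (site (eta0 n) k)%:R / n.+1%:R : R) @ \oo --> u k)
    (u_ge0 : forall k : nat, 0 <= u k)
    (u_noninc : forall k l : nat, (k <= l)%N -> u l <= u k).

Let x (k n : nat) : R := (site (eta0 n) k)%:R / n.+1%:R.
Let rhon (n : nat) : R := (m n.+1)%:R / n.+1%:R.

Lemma rhon_cvg : rhon @ \oo --> rho.
Proof. by have := m_cvg; rewrite -cvg_shiftS. Qed.

Let x_density n (i : 'I_n.+1) : density R i (eta0 n) = x i n.
Proof. by rewrite /density /x site_ord. Qed.

Let x_ge0 k n : 0 <= x k n. Proof. exact: divr_ge0. Qed.

(** Fatou's lemma, applied to partial sums of the densities. *)
Lemma big_occupation_sum k : \sum_(j < k) u j <= rho.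
Proof.
have cvs : (fun n => \sum_(j < k) x j n) @ \oo --> \sum_(j < k) u j.
  by apply: cvg_big => [|j _]; [exact: add_continuous|exact: eta0_cvg].
apply: (ler_cvg_to cvs rhon_cvg); near=> n.
have kn : (k <= n.+1)%N by near: n; exists k => // n /= /leqW.
rewrite -(sum_head (fun j => x j n) kn) /rhon -(sum_density R (eta0 n)).
rewrite [leRHS](bigID (fun i : 'I_n.+1 => (i < k)%N)) /=.
under [X in X + _]eq_bigr do rewrite x_density.
by rewrite lerDl; apply: sumr_ge0 => i _; exact: density_ge0.
Unshelve. all: by end_near. Qed.

Let x_le_K K n (i : 'I_n.+1) : (K <= n)%N -> ~~ (i < K)%N ->
  density R i (eta0 n) <= x K n.
Proof.
rewrite -leqNgt => Kn Ki.
have -> : x K n = density R (Ordinal (Kn : (K < n.+1)%N)) (eta0 n).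
  by rewrite x_density.
rewrite /density ler_pM2r ?invr_gt0 // ler_nat.
exact: eta0_sorted.
Qed.

Let tail_density K n : \sum_(i < n.+1 | ~~ (i < K)%N) density R i (eta0 n) <= rhon n.
Proof.
rewrite /rhon -(sum_density R (eta0 n)).
rewrite [leRHS](bigID (fun i : 'I_n.+1 => (i < K)%N)) /= lerDr.
by apply: sumr_ge0 => i _; exact: density_ge0.
Qed.

(** In a sorted configuration each site from [K] on is below site [K], so the cubes
    are at most [x_K ^+ 2] times the density. *)
Lemma initial_tail_cube K (d : R) : u K ^+ 2 * rho < d ->
  \forall n \near \oo, tail_cube R K (eta0 n) <= d.
Proof.
move=> ud.
have cv : (fun n => x K n ^+ 2 * rhon n) @ \oo --> u K ^+ 2 * rho.
  apply: cvgM rhon_cvg.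
  exact: (cvg_comp _ _ (@eta0_cvg K) (@exprn_continuous _ 2 (u K))).
near=> n; apply: (@le_trans _ _ (x K n ^+ 2 * rhon n)); last first.
  by near: n; exact: (cvgr_le _ cv).
have Kn : (K <= n)%N by near: n; exists K.
apply: (@le_trans _ _ (\sum_(i < n.+1 | ~~ (i < K)%N)
    x K n ^+ 2 * density R i (eta0 n))).
  apply: ler_sum => i iK; rewrite exprSr ler_wpM2r ?density_ge0 //.
  by rewrite ler_sqr ?nnegrE ?density_ge0 //; exact: x_le_K.
by rewrite -mulr_sumr ler_wpM2l ?sqr_ge0.
Unshelve. all: by end_near. Qed.

Lemma initial_discrepancy K (d : R) : 0 < d ->
  \forall n \near \oo, discrepancy u K (eta0 n) 0 (eta0 n) <= d.
Proof.
move=> d0.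
have cv : (fun n => \sum_(j < K) (x j n - u j) ^+ 2) @ \oo -->
    \sum_(j < K) (u j - u j) ^+ 2.
  apply: cvg_big => [|j _]; first exact: add_continuous.
  have cj : (fun n => x j n - u j) @ \oo --> u j - u j.
    by apply: cvgB; [exact: eta0_cvg|exact: cvg_cst].
  exact: (cvg_comp _ _ cj (@exprn_continuous _ 2 _)).
rewrite big1 in cv; last by move=> j _; rewrite subrr expr0n.
near=> n; have Kn : (K <= n.+1)%N by near: n; exists K => // n /= /leqW.
have W0 : clock (eta0 n) (0 : R) (eta0 n) = 0.
  by rewrite /clock subrr mul0r mulr0 addr0 mul0r.
rewrite /discrepancy W0 subrr maxxx subrr expr0n addr0.
rewrite (eq_bigr (fun i : 'I_n.+1 => (x i n - u i) ^+ 2)); last first.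
  by move=> i _; rewrite x_density subr0 max_l.
rewrite (sum_head (fun j => (x j n - u j) ^+ 2) Kn).
by near: n; exact: (cvgr_le _ cv).
Unshelve. all: by end_near. Qed.

(** The first [K] squares converge, and the remaining ones are at most [x_K] times
    the density, which tends to [u K * rho]. *)
Lemma initial_energy K (d : R) : u K * rho < d ->
  \forall n \near \oo, `|energy R (eta0 n) / 2 - bulk_energy u 0| <= d.
Proof.
move=> ud.
have e0 : 0 < d - u K * rho by rewrite subr_gt0.
have cv1 : (fun n => \sum_(j < K) x j n ^+ 2 / 2 - \sum_(j < K) u j ^+ 2 / 2
    + x K n * rhon n / 2) @ \oo -->
    \sum_(j < K) u j ^+ 2 / 2 - \sum_(j < K) u j ^+ 2 / 2 + u K * rho / 2.
  apply: cvgD; last by apply: cvgMl; exact: cvgM (@eta0_cvg K) rhon_cvg.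
  apply: cvgB; last exact: cvg_cst.
  apply: cvg_big => [|j _]; first exact: add_continuous.
  apply: cvgMl.
  exact: (cvg_comp _ _ (@eta0_cvg j) (@exprn_continuous _ 2 (u j))).
have cv2 : (fun n => \sum_(j < K) x j n ^+ 2 / 2 - \sum_(j < K) u j ^+ 2 / 2)
    @ \oo --> \sum_(j < K) u j ^+ 2 / 2 - \sum_(j < K) u j ^+ 2 / 2.
  apply: cvgB; last exact: cvg_cst.
  apply: cvg_big => [|j _]; first exact: add_continuous.
  apply: cvgMl.
  exact: (cvg_comp _ _ (@eta0_cvg j) (@exprn_continuous _ 2 (u j))).
rewrite subrr in cv2; rewrite subrr add0r in cv1.
have rho0 := rho_ge0 big_occupation_sum.
have uK0 : 0 <= u K * rho by rewrite mulr_ge0.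
have := bulk_energy_truncate u_ge0 big_occupation_sum u_noninc K (lexx 0).
under eq_bigr do rewrite /excess subr0 max_l //.
move=> /andP[be1 be2].
near=> n; have Kn : (K <= n)%N by near: n; exists K.
have up : \sum_(j < K) x j n ^+ 2 / 2 - \sum_(j < K) u j ^+ 2 / 2
    + x K n * rhon n / 2 <= d.
  by near: n; apply: (cvgr_le _ cv1); lra.
have lo : - (d - u K * rho / 2) <= \sum_(j < K) x j n ^+ 2 / 2 - \sum_(j < K) u j ^+ 2 / 2.
  by near: n; apply: (cvgr_ge _ cv2); lra.
have split_energy : energy R (eta0 n) / 2 = \sum_(j < K) x j n ^+ 2 / 2
   + \sum_(i < n.+1 | ~~ (i < K)%N) density R i (eta0 n) ^+ 2 / 2.
  rewrite -(sum_head (fun j => x j n ^+ 2 / 2) (leqW Kn)) -!mulr_suml -mulrDl.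
  rewrite /energy (bigID (fun i : 'I_n.+1 => (i < K)%N)) /=.
  by under eq_bigr do rewrite x_density.
have tail0 : 0 <= \sum_(i < n.+1 | ~~ (i < K)%N) density R i (eta0 n) ^+ 2 / 2.
  by apply: sumr_ge0 => i _; rewrite divr_ge0 // sqr_ge0.
have tail1 : \sum_(i < n.+1 | ~~ (i < K)%N) density R i (eta0 n) ^+ 2 / 2 <=
    x K n * rhon n / 2.
  rewrite -mulr_suml ler_wpM2r ?invr_ge0 //.
  apply: (@le_trans _ _ (\sum_(i < n.+1 | ~~ (i < K)%N)
      x K n * density R i (eta0 n))).
    by apply: ler_sum => i iK; rewrite expr2 ler_wpM2r ?density_ge0 // x_le_K.
  by rewrite -mulr_sumr ler_wpM2l.
rewrite ler_norml split_energy; apply/andP; split; lra.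
Unshelve. all: by end_near. Qed.

End initial.

(** * Measurability of the supremum *)

Section sup_measurable.
Context (R : realType) (d : measure_display) (W : measurableType d)
  (P : probability W R) (S : choiceType) (L : (S -> R) -> S -> R) (x0 : S)
  (X : R -> W -> S) (E : seq S).
Context (X_markov : is_markov_process P L x0 X).
Context (inE : forall y, y \in E).

(** By right-continuity of the paths, the supremum exceeds [c] if and only if the
    process does at some point of a dyadic grid, which is a countable union of
    measurable events. *)
Lemma measurable_sup (T : R) (g : R -> S -> R) (b : R) : 0 <= T ->
  (forall x, continuous (g^~ x)) -> (forall t x, g t x <= b) ->
  measurable_fun [set: W] (fun w => sup [set g t (X t w) | t in `[0, T]]).
Proof.
move=> T0 gc gb; apply: (measurability _ (RGenOInfty.measurableE R)).
move=> _ [_ [c ->] <-]; rewrite setTI.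
pose h l := T / (2 ^ l)%:R.
have p0 l : 0 < (2 ^ l)%:R :> R by rewrite ltr0n expn_gt0.
have h0 l : 0 <= h l by rewrite divr_ge0 // ltW.
have -> : (fun w => sup [set g t (X t w) | t in `[0, T]]) @^-1` `]c, +oo[ =
    \bigcup_l \bigcup_(j in [set j | (j <= 2 ^ l)%N])
      [set w | c < g (j%:R * h l) (X (j%:R * h l) w)].
  apply/seteqP; split => w /=; rewrite in_itv /= andbT.
    move=> /sup_gt[|_ [t + <-] cg].
      by exists (g 0 (X 0 w)), 0 => //=; rewrite in_itv /= lexx.
    rewrite /= in_itv /= => /andP[t0 tT].
    move: tT; rewrite le_eqVlt => /predU1P[tE|tT].
      exists 0%N => //; exists 1%N => //=.
      by rewrite /h expn0 mul1r divr1 -tE.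
    suff [l [j [jl cgj]]] : exists l j, (j <= 2 ^ l)%N /\
        c < g (j%:R * h l) (X (j%:R * h l) w).
      by exists l => //; exists j.
    apply: (@dyadic_right_dense _ T t (fun s => c < g s (X s w))); first by rewrite t0.
    have := mp_right_continuous X_markov w t0.
    have : \forall s \near t^'+, c < g s (X t w).
      by apply: cvgr_gt cg; apply: cvg_at_right_filter; exact: gc.
    by apply: filterS2 => s cgs ->.
  move=> [l _ [j /= jl cg]]; apply: lt_le_trans cg _.
  apply: ub_le_sup.
    by exists b => _ [t _ <-].
  exists (j%:R * h l) => //=; rewrite in_itv /= mulr_ge0 //= /h mulrA.
  by rewrite ler_pdivrMr // mulrC ler_wpM2l // ler_nat.
apply: bigcup_measurable => l _; apply: bigcup_measurable => j _.
apply: (measurable_state X_markov inE (fun x => c < g (j%:R * h l) x)).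
by rewrite mulr_ge0.
Qed.

End sup_measurable.

(** * The fluid limit *)

Section fluid_limit.
Context (R : realType) (rho : R) (m : nat -> nat)
    (eta0 : forall n : nat, Omega n.+1 (m n.+1)) (u : nat -> R)
    (d : nat -> measure_display) (W : forall n : nat, measurableType (d n))
    (P : forall n : nat, probability (W n) R)
    (eta : forall n : nat, R -> W n -> Omega n.+1 (m n.+1)).
Context (m_cvg : (fun n : nat => (m n)%:R / n%:R : R) @ \oo --> rho)
    (eta0_sorted : forall (n : nat) (i j : 'I_n.+1),
      (i <= j)%N -> (occ (eta0 n) j <= occ (eta0 n) i)%N)
    (eta0_cvg : forall k : nat,
      (fun n : nat => (site (eta0 n) k)%:R / n.+1%:R : R) @ \oo --> u k)
    (u_ge0 : forall k : nat, 0 <= u k)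
    (u_noninc : forall k l : nat, (k <= l)%N -> u l <= u k)
    (eta_zrp : forall n : nat,
      is_zero_range_process (P n) (eta0 n) (@eta n)).
Context (omega : R -> R) (omega_ge0 : forall t, 0 <= omega t)
  (potential_omega : forall t,
    potential rho u (omega t) = potential rho u 0 + Num.max t 0).

Let u_sum := big_occupation_sum m_cvg eta0_cvg.

(** The masses are summable, hence tend to [0]. *)
Lemma exists_truncation (i : nat) (e : R) : 0 < e ->
  exists K : nat, [/\ (i < K)%N, u K <= e, u K * rho < e & u K ^+ 2 * rho < e].
Proof.
move=> e0.
have u0 : u @ \oo --> 0.
  apply: cvg_series_cvg_0.
  by apply: (@series_bounded_cvg R rho u u_sum) => j; rewrite u_ge0 lexx.
have u1 : (fun k => u k * rho) @ \oo --> 0.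
  by rewrite -[X in _ --> X](mul0r rho); apply: cvgMl.
have u2 : (fun k => u k ^+ 2 * rho) @ \oo --> 0.
  rewrite -[X in _ --> X](mul0r rho) -[X in X * rho](expr0n R 2) ; apply: cvgMl.
  exact: (cvg_comp _ _ u0 (@exprn_continuous _ 2 0)).
near \oo => K; exists K; split; near: K.
- by exists i.+1.
- exact: (cvgr_le _ u0).
- exact: (cvgr_lt _ u1).
- exact: (cvgr_lt _ u2).
Unshelve. all: by end_near. Qed.

(** The truncation level [K] is fixed first, for the initial cubes to be small
    compared with the threshold [tau ^+ 2]; they do not vanish as [n] grows.  The
    initial discrepancy does, which permits the large weight [K.+1 ^+ 2] on the
    discrepancy that [stability] requires. *)
Lemma fluid_deviation (T e sg : R) (i : nat) : 0 <= T -> 0 < e -> 0 < sg ->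
  \forall n \near \oo, exists B : set (W n),
    [/\ measurable B, (P n B <= sg%:E)%E &
      forall w, ~ B w -> forall t, 0 <= t <= T ->
        `|(site (@eta n (n.+1%:R * t) w) i)%:R / n.+1%:R
          - excess u (omega t) i| <= e].
Proof.
move=> T0 e0 sg0.
have rho0 : 0 <= rho := rho_ge0 u_sum.
have be0 : 0 <= bulk_energy u 0.
  have /andP[+ _] := bulk_energy_truncate u_ge0 u_sum u_noninc 0 (lexx 0).
  by rewrite big_ord0.
pose C := stability_constant rho T u.
have C0 : 0 < C by rewrite /C /stability_constant; lra.
pose tau := Num.min (1 / 2) (e / C).
have tau0 : 0 < tau by rewrite lt_min !divr_gt0.
have tau1 : tau <= 1 / 2 by rewrite ge_min lexx.
have tauC : tau * C <= e by rewrite -ler_pdivlMr // ge_min lexx orbT.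
pose a := tau ^+ 2.
have a0 : 0 < a by rewrite exprn_gt0.
have sga0 : 0 < sg * a / 4 by rewrite divr_gt0 // mulr_gt0.
pose dl := Num.min tau (sg * a / 4).
have dl0 : 0 < dl by rewrite lt_min tau0.
have dl_tau : dl <= tau by rewrite ge_min lexx.
have dl_sg : dl <= sg * a / 4 by rewrite ge_min lexx orbT.
have [K [iK /le_trans/(_ dl_tau) uK1 /lt_le_trans/(_ dl_tau) uK2
  /lt_le_trans/(_ dl_sg) uK3]] := exists_truncation i dl0.
(* On the event [M * discrepancy <= tau ^+ 2] the discrepancy is within the
   tolerance of [stability]. *)
pose M : R := K.+1%:R ^+ 2.
have M0 : 0 < M by rewrite exprn_gt0.
(* The drifts accumulated up to time [n.+1 * T] add up to at most [D / n.+1]. *)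
pose D := T * (M * (12 * (K%:R + 1)) + 6 * (rho + 1) + 1).
have inv_cvg : (fun n => n.+1%:R^-1 : R) @ \oo --> 0 by exact: cvg_harmonic.
have D_cvg : (fun n => D * n.+1%:R^-1 : R) @ \oo --> 0.
  by rewrite -[X in _ --> X](mulr0 D); apply: cvgMr.
near=> n.
have Kn : (K <= n.+1)%N by near: n; exists K => // n /= /leqW.
have disc0 : discrepancy u K (eta0 n) 0 (eta0 n) <= sg * a / 4 / M.
  by near: n; apply: initial_discrepancy => //; rewrite divr_gt0.
have tail0 : tail_cube R K (eta0 n) <= sg * a / 4.
  by near: n; apply: (initial_tail_cube m_cvg).
have energy0 : `|energy R (eta0 n) / 2 - bulk_energy u 0| <= tau.
  near: n; exact: (initial_energy m_cvg eta0_sorted eta0_cvg u_ge0 u_noninc uK2).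
have rhon1 : `|rho - (m n.+1)%:R / n.+1%:R| <= tau.
  near: n; move/cvgrPdist_le : (rhon_cvg m_cvg); exact.
have ninv : n.+1%:R^-1 <= tau :> R by near: n; exact: (cvgr_le _ inv_cvg).
have Dn : D * n.+1%:R^-1 <= sg * a / 4 by near: n; exact: (cvgr_le _ D_cvg).
have [E uE inE] := Omega_enum n.+1 (m n.+1).
pose rhon : R := (m n.+1)%:R / n.+1%:R.
have rhon0 : 0 <= rhon by rewrite divr_ge0.
have rhon_le : rhon <= rho + 1 by move: rhon1; rewrite -/rhon ler_norml; lra.
have theta0 : 0 < 1 + rhon - n.+1%:R^-1.
  by rewrite subr_gt0; apply: le_lt_trans (le_trans ninv tau1) _; lra.
pose F (t : R) (z : Omega n.+1 (m n.+1)) :=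
  M * discrepancy u K (eta0 n) t z + tail_cube R K z.
pose eps := M * (\sum_(i < n.+1 | (i < K)%N) 12 * n.+1%:R^-1 ^+ 2 +
  12 * n.+1%:R^-1 ^+ 2) + (6 * rhon + 1) * n.+1%:R^-1 ^+ 2.
have FL := @lyapunov_zero_range R n.+1 (m n.+1) E (n.+1%:R * T) (ltn0Sn n) inE
  theta0 u K M (eta0 n) (ltW M0) : lyapunov _ _ F eps.
have F0 t z : 0 <= F t z.
  apply: addr_ge0.
    apply: mulr_ge0; first exact: ltW.
    by apply: addr_ge0; [apply: sumr_ge0 => k _|]; exact: sqr_ge0.
  by apply: sumr_ge0 => k _; rewrite exprn_ge0 // density_ge0.
have epsE : eps = (M * (12 * (K%:R + 1)) + 6 * rhon + 1) * n.+1%:R^-1 ^+ 2.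
  rewrite /eps (sum_head (fun=> 12 * n.+1%:R^-1 ^+ 2) Kn) sumr_const card_ord.
  by rewrite -[_ *+ K]mulr_natr /rhon; ring.
have eps0 : 0 <= eps.
  rewrite epsE; apply: mulr_ge0; last exact: sqr_ge0.
  apply: addr_ge0 => //; apply: addr_ge0; last exact: mulr_ge0.
  by apply: mulr_ge0; [exact: ltW|rewrite mulr_ge0 // addr_ge0].
have NT0 : 0 <= n.+1%:R * T by rewrite mulr_ge0.
have [B [mB PB HB]] := lyapunov_maximal_inequality (eta_zrp n) inE uE
  (@zrp_linear R n.+1 (m n.+1)) (@zrp_bounded R n.+1 (m n.+1) (ltn0Sn n))
  NT0 a0 eps0 F0 FL.
exists B; split => //.
  apply: le_trans PB _; rewrite lee_fin ler_pdivrMr //.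
  have F00 : F 0 (eta0 n) <= sg * a / 2.
    have : M * discrepancy u K (eta0 n) 0 (eta0 n) <= sg * a / 4.
      by rewrite mulrC -ler_pdivlMr.
    by rewrite /F; lra.
  have : eps * (n.+1%:R * T) <= sg * a / 4.
    apply: le_trans Dn; rewrite epsE /D.
    rewrite (_ : _ * (n.+1%:R * T) =
      T * (M * (12 * (K%:R + 1)) + 6 * rhon + 1) * n.+1%:R^-1); last first.
      by field.
    rewrite ler_wpM2r ?invr_ge0 // ler_wpM2l //; lra.
  lra.
move=> w Bw t /andP[t0 tT].
have tN : 0 <= n.+1%:R * t <= n.+1%:R * T by rewrite mulr_ge0 //= ler_wpM2l.
have FX := HB w Bw _ tN.
set X := @eta n (n.+1%:R * t) w in FX *.
have disc_ge0 : 0 <= discrepancy u K (eta0 n) (n.+1%:R * t) X.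
  by rewrite addr_ge0 ?sqr_ge0 // sumr_ge0 // => k _; exact: sqr_ge0.
have tail_ge0 : 0 <= tail_cube R K X.
  by apply: sumr_ge0 => k _; rewrite exprn_ge0 // density_ge0.
have disc_le : discrepancy u K (eta0 n) (n.+1%:R * t) X <= (tau / K.+1%:R) ^+ 2.
  rewrite exprMn exprVn -/M ler_pdivlMr // mulrC.
  by apply: le_trans FX; rewrite /F lerDl.
have tail_le : tail_cube R K X <= tau ^+ 2.
  by apply: le_trans FX; rewrite /F lerDr mulr_ge0 // ltW.
have iN : (i < n.+1)%N by exact: leq_trans iK Kn.
have t01 : 0 <= t <= T by rewrite t0.
have tau01 : 0 < tau <= 1 / 2 by rewrite tau0.
have := @stability R rho T u u_ge0 u_sum u_noninc omega omega_ge0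
  potential_omega n.+1 (m n.+1) K (eta0 n) X tau t (Ordinal iN)
  (ltn0Sn n) iK Kn t01 tau01 disc_le tail_le uK1 rhon1 ninv energy0.
rewrite /density -site_ord /= => h; exact: le_trans h tauC.
Unshelve. all: by end_near. Qed.

End fluid_limit.

(* The number of sites n >= 1 is written n.+1. *)
Theorem proposition4 (R : realType) (rho : R) (m : nat -> nat)
    (eta0 : forall n : nat, Omega n.+1 (m n.+1)) (u : nat -> R)
    (d : nat -> measure_display) (W : forall n : nat, measurableType (d n))
    (P : forall n : nat, probability (W n) R)
    (eta : forall n : nat, R -> W n -> Omega n.+1 (m n.+1))
    (rho_gt0 : 0 < rho)
    (m_cvg : (fun n : nat => (m n)%:R / n%:R : R) @ \oo --> rho)
    (eta0_sorted : forall (n : nat) (i j : 'I_n.+1),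
      (i <= j)%N -> (occ (eta0 n) j <= occ (eta0 n) i)%N)
    (eta0_cvg : forall k : nat,
      (fun n : nat => (site (eta0 n) k)%:R / n.+1%:R : R) @ \oo --> u k)
    (u_ge0 : forall k : nat, 0 <= u k)
    (u_noninc : forall k l : nat, (k <= l)%N -> u l <= u k)
    (eta_zrp : forall n : nat,
      is_zero_range_process (P n) (eta0 n) (eta n)) :
  exists v : nat -> R -> R,
    [/\ forall i : nat, measurable_fun (`[0, +oo[ : set R) (v i),
        forall (i : nat) (t : R), 0 <= t -> 0 <= v i t <= u i,
        forall (i : nat) (t : R), 0 <= t ->
          v i t = Num.max
            (u i - \int[lebesgue_measure]_(s in `[0, t])
                     (1 / (1 + rho - limn (series (fun j : nat => v j s)))))
            0 &
        forall (T : R) (i : nat), 0 <= T ->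
          cvg_in_probability P
            (fun (n : nat) (w : W n) =>
               sup [set `|(site (eta n (n.+1%:R * t) w) i)%:R / n.+1%:R - v i t|
                   | t in `[0, T]])
            0].
Proof.
have u_sum := big_occupation_sum m_cvg eta0_cvg.
have [omega omegaP] := consumption_exists u_ge0 u_sum.
have omega_ge0 t : 0 <= omega t by have [] := omegaP t.
have potential_omega t :
    potential rho u (omega t) = potential rho u 0 + Num.max t 0.
  by have [] := omegaP t.
have v_cont i : continuous (fun t => excess u (omega t) i).
  move=> t; apply/cvgrPdist_le => e e0; near=> s.
  apply: le_trans (pos_part_lipschitz _ _) _.
  rewrite opprB addrC subrKA distrC.
  apply: le_trans (omega_lipschitz u_ge0 u_sum omega_ge0 potential_omega _ _) _.
  by near: s; apply: cvgr_dist_le => //; exact: cvg_id.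
exists (fun i t => excess u (omega t) i); split.
- move=> i; apply: measurable_funTS; exact: continuous_measurable_fun.
- by move=> i t _; rewrite excess_ge0 excess_le.
- move=> i t t0.
  by rewrite (omega_integral u_ge0 u_sum omega_ge0 potential_omega t0).
- move=> T i T0.
  pose Y n (w : W n) := sup [set `|(site (eta n (n.+1%:R * t) w) i)%:R /
    n.+1%:R - excess u (omega t) i| | t in `[0, T]].
  have gb n : exists b, forall (t : R) (x : Omega n.+1 (m n.+1)),
      `|(site x i)%:R / n.+1%:R - excess u (omega t) i| <= b.
    have [E _ inE] := Omega_enum n.+1 (m n.+1).
    have [b _ hb] := finite_bounded inE (fun x => (site x i)%:R / n.+1%:R : R).
    exists (b + u i) => t x; apply: le_trans (ler_normB _ _) (lerD (hb x) _).
    by rewrite ger0_norm ?excess_ge0 // excess_le.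
  have mY n : measurable_fun [set: W n] (@Y n).
    have [E _ inE] := Omega_enum n.+1 (m n.+1); have [b hb] := gb n.
    have N0 : 0 < n.+1%:R :> R by [].
    (* The supremum in the original time of the process. *)
    have -> : @Y n = fun w => sup [set `|(site (eta n t w) i)%:R / n.+1%:R -
        excess u (omega (t / n.+1%:R)) i| | t in `[0, n.+1%:R * T]].
      apply/funext => w; congr sup.
      apply/seteqP; split => _ [t /= + <-]; rewrite in_itv /= => /andP[t0 tT].
        exists (n.+1%:R * t); last by rewrite mulrAC mulfV ?mul1r ?gt_eqF.
        by rewrite in_itv /= mulr_ge0 //= ler_wpM2l.
      exists (t / n.+1%:R); last by rewrite [_ * (t / _)]mulrCA mulfV ?mulr1 ?gt_eqF.
      by rewrite in_itv /= divr_ge0 //= ler_pdivrMr // mulrC.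
    apply: (measurable_sup (eta_zrp n) inE (g := fun t x =>
      `|(site x i)%:R / n.+1%:R - excess u (omega (t / n.+1%:R)) i|) (b := b)).
    + by rewrite mulr_ge0.
    + move=> x t; apply: cvg_norm; apply: cvgB; first exact: cvg_cst.
      have scale : (s / n.+1%:R : R) @[s --> t] --> t / n.+1%:R.
        by apply: cvgMl; exact: cvg_id.
      exact: (cvg_comp _ _ scale (v_cont i (t / n.+1%:R))).
    + by move=> t x; exact: hb.
  split=> [n|e e0]; first exact: mY.
  have mA n : measurable [set w | e <= `|@Y n w - 0|].
    have mN : measurable_fun [set: W n] (fun w => `|@Y n w - 0|).
      apply: measurableT_comp => //; apply: measurable_funB => //; exact: mY.
    have := mN measurableT _ (measurable_itv `[e, +oo[).
    rewrite setTI (_ : _ @^-1` _ = [set w | e <= `|@Y n w - 0|]) //.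
    by apply/seteqP; split => w /=; rewrite in_itv /= andbT.
  apply/fine_cvgP; split.
    by apply: nearW => n; exact: fin_num_measure.
  apply/cvgrPdist_le => sg sg0.
  have e2 : 0 < e / 2 by rewrite divr_gt0.
  have := fluid_deviation m_cvg eta0_sorted eta0_cvg u_ge0 u_noninc eta_zrp
    omega_ge0 potential_omega i T0 e2 sg0.
  apply: filterS => n [B [mB PB HB]].
  rewrite sub0r normrN ger0_norm ?fine_ge0 //.
  rewrite -lee_fin fineK ?fin_num_measure //.
  apply: le_trans PB; apply: le_measure; rewrite ?inE //.
  move=> w /= eY; apply: contrapT => Bw; move: eY; rewrite subr0 leNgt => /negP; apply.
  have Y_le : @Y n w <= e / 2.
    apply: ge_sup.
      by exists `|(site (eta n (n.+1%:R * 0) w) i)%:R / n.+1%:R -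
        excess u (omega 0) i|, 0 => //=; rewrite in_itv /= lexx.
    by move=> _ [t /= + <-]; rewrite in_itv /= => ?; exact: HB.
  have Y_ge : 0 <= @Y n w.
    have [b hb] := gb n.
    apply: le_trans (normr_ge0 _) (ub_le_sup _ _); last first.
      by exists 0 => //=; rewrite in_itv /= lexx.
    by exists b => _ [t _ <-]; exact: hb.
  by rewrite (ger0_norm Y_ge); apply: le_lt_trans Y_le _; lra.
Unshelve. all: by end_near. Qed.
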